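(* Let $\Phi\subset\mathbb{R}^2$ be a homogeneous Poisson point process of intensity $\lambda>0$ (base station locations), with Voronoi cells $V_\Phi(X)=\{y\in\mathbb{R}^2:|y-X|\le|y-X'|\ \forall X'\in\Phi\}$. Fix $n\in\mathbb{N}$. Each $X\in\Phi$ carries $2^n$ beams of equal angular width $2\pi/2^n$, separated by $2^{n-1}$ beam-boundary lines through $X$ with directions $\theta_X+k\pi/2^{n-1}$ (mod $\pi$), $k=0,\dots,2^{n-1}-1$, where the $\theta_X$ are i.i.d. uniform on $[0,\pi)$ and independent of $\Phi$. A mobile terminal moves along the $x$-axis with constant speed $v>0$. A beam reselection point is a point of the $x$-axis that lies on a beam-boundary line of some $X\in\Phi$ and belongs to the Voronoi cell $V_\Phi(X)$; let $\Psi$ be the point process of these points on $\mathbb{R}$. Then $\Psi$ has linear intensity $\mu_{\rm s,b}=\frac{2^n\sqrt{\lambda}}{\pi}$, i.e. $\mathbb{E}[\Psi([0,\ell])]=\frac{2^n\sqrt{\lambda}}{\pi}\ell$ for all $\ell>0$, and consequently the expected number of beam reselections per unit time of the moving terminal is $\mu_{\rm t,b}(n)=\frac{2^n\sqrt{\lambda}}{\pi}v$. *)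

(* Defs.v *)
From HB Require Import structures.
From mathcomp Require Import all_boot all_order all_algebra.
From mathcomp Require Import all_classical all_reals all_analysis.
Set Implicit Arguments. Unset Strict Implicit. Unset Printing Implicit Defensive.
Import Order.TTheory GRing.Theory Num.Theory.
Import numFieldNormedType.Exports.
Local Open Scope classical_set_scope.
Local Open Scope ring_scope.

Section Defs.
Context {R : realType}.

(* squared Euclidean distance in R^2 (the norm on R*R in the library is the max norm) *)
Definition sqdist (x y : R * R) : R := (x.1 - y.1) ^+ 2 + (x.2 - y.2) ^+ 2.

Definition area (B : set (R * R)) : \bar R :=
  ((@lebesgue_measure R) \x (@lebesgue_measure R))%E B.

Definition bounded2 (B : set (R * R)) : Prop :=
  exists r : R, B `<=` [set x | `|x.1| <= r /\ `|x.2| <= r].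

Definition count_in (X : nat -> R * R) (B : set (R * R)) : \bar R :=
  counting (X @^-1` B).

(* Poisson(m) probability mass function, m >= 0 (m = 0 gives the Dirac mass at 0) *)
Definition poisson_law (m : R) (k : nat) : R := m ^+ k / k`!%:R * expR (- m).

Definition unif_angle (A : set R) : R :=
  fine ((@lebesgue_measure R) (A `&` `[0, pi[)) / pi.

Definition on_line (X : R * R) (phi : R) (y : R * R) : Prop :=
  (y.1 - X.1) * sin phi - (y.2 - X.2) * cos phi = 0.

Definition voronoi (Phi : set (R * R)) (X : R * R) : set (R * R) :=
  [set y | forall X', Phi X' -> sqdist y X <= sqdist y X'].

Definition beam_reselection_points (n : nat) (X : nat -> R * R) (th : nat -> R)
  : set R :=
  [set s | exists i k, (k < 2 ^ (n - 1))%N /\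
      on_line (X i) (th i + k%:R * pi / 2 ^+ (n - 1)) (s, 0) /\
      voronoi (range X) (X i) (s, 0)].

Definition count_Psi (n : nat) (X : nat -> R * R) (th : nat -> R) (a b : R)
  : \bar R :=
  (\esum_(s in beam_reselection_points n X th `&` `[a, b]) 1)%E.

Context {d : measure_display} {T : measurableType d} (P : probability T R).

Definition homogeneous_PPP (lam : R) (X : T -> nat -> R * R) : Prop :=
  (forall i, measurable_fun setT (fun w => X w i)) /\
  (forall w, injective (X w)) /\
  (forall (m : nat) (B : 'I_m -> set (R * R)) (k : 'I_m -> nat),
     (forall j, measurable (B j) /\ bounded2 (B j)) ->
     (forall j j', j != j' -> B j `&` B j' = set0) ->
     P (\bigcap_(j in [set: 'I_m]) [set w | count_in (X w) (B j) = (k j)%:R%:E])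
     = (\prod_(j < m) poisson_law (lam * fine (area (B j))) (k j))%:E).

Definition iid_uniform_marks (X : T -> nat -> R * R) (th : T -> nat -> R) : Prop :=
  (forall i, measurable_fun setT (fun w => th w i)) /\
  (forall (m : nat) (C : nat -> set (R * R)) (A : nat -> set R),
     (forall i, measurable (C i)) -> (forall i, measurable (A i)) ->
     P (\bigcap_(i in `I_m) ([set w | C i (X w i)] `&` [set w | A i (th w i)]))
     = (P (\bigcap_(i in `I_m) [set w | C i (X w i)])
        * (\prod_(i < m) unif_angle (A i))%:E)%E).

End Defs.

(* Main.v *)
Require Import Defs.
From HB Require Import structures.
From mathcomp Require Import all_boot all_order all_algebra.
From mathcomp Require Import all_classical all_reals all_analysis.
From mathcomp Require Import measurable_realfun ring lra.
Set Implicit Arguments. Unset Strict Implicit. Unset Printing Implicit Defensive.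
Import Order.TTheory GRing.Theory Num.Theory.
Import numFieldNormedType.Exports.
Local Open Scope classical_set_scope.
Local Open Scope ring_scope.

(** Almost surely the reselection points are the distinct abscissas [s] where the
   [k]-th line of some point [x] meets the axis inside the cell of [x], so the
   expectation is a sum over [x] and [k] of probabilities. The angle of [x] is
   uniform and independent of everything else, and a uniformly oriented line
   through [x] meets the axis with density [|x.2| / (pi * |x - (s, 0)|^2)]. All
   [2^(n-1)] lines of [x] contribute equally; integrating out the angles leaves
   [2^(n-1) / pi] times the integral over [s] of the mean of
   [|x.2| / |x - (s, 0)|^2] over the point [x] closest to [(s, 0)].

   That closest point has density [lam * exp (- lam * pi * |x - (s, 0)|^2)]: cutting
   the plane into thin annuli around [(s, 0)], the expected number of points of
   an annulus, on the event that the disc inside it is void, bounds the law from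
   above, and both have mass 1. The resulting Gaussian integral is [2 sqrt lam]. *)

(** * Integration *)

(** The enumeration [X w] is arbitrary: the law of a single point [X w i] is not prescribed, and the
    Poisson hypothesis speaks only of counts in disjoint bounded sets. Statements about the closest
    point are therefore sums over all indices, and that hypothesis is applied to one or two sets at
    a time, typically a void disc and a count next to it.

    Whether a crossing lies in the cell of its own point depends on the very angle that produces it.
    The event is therefore a set of pairs: a component that sees all points and all other angles,
    and an abscissa. The angle is integrated out with the first component frozen.

    Reselection points form a set, so crossings that coincide count once; the other angles enter the
    argument only to rule out such coincidences. The count itself is not shown to be measurable: off
    a null set it is a double series of indicators, and its integral is handled as a supremum. *)

Section lower_integral.
Local Open Scope ereal_scope.
Context d (T : measurableType d) (R : realType).
Variable mu : {measure set T -> \bar R}.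

Lemma measurable_fun_in (A : set T) : measurable A ->
  measurable_fun setT (fun x => x \in A).
Proof.
move=> mA; apply: (measurable_fun_bool true).
by rewrite setTI (_ : _ @^-1` _ = A)//; apply/seteqP; split => x /=;
  [exact: set_mem|exact: mem_set].
Qed.

(** The simple functions below [f] are among those below [g], so the suprema compare without any
    measurability. *)
Lemma ge0_le_integralT (f g : T -> \bar R) :
  (forall x, 0 <= f x) -> (forall x, f x <= g x) ->
  \int[mu]_x f x <= \int[mu]_x g x.
Proof.
move=> f0 fg; have g0 x : 0 <= g x by exact: le_trans (fg x).
rewrite !ge0_integralTE//; apply: le_ereal_sup.
by apply: image_subset => h /= hf x; exact: le_trans (fg x).
Qed.

(* [f] need not be measurable: its integral is then a supremum over simple
   functions below it, hence still insensitive to null sets. *)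
Lemma ge0_integral_eq_off_null (f g : T -> \bar R) (N : set T) :
  measurable N -> mu N = 0 -> measurable_fun setT g ->
  (forall x, 0 <= f x) -> (forall x, 0 <= g x) ->
  (forall x, ~ N x -> f x = g x) ->
  \int[mu]_x f x = \int[mu]_x g x.
Proof.
move=> mN N0 mg f0 g0 fg.
have eqN (h : T -> \bar R) : measurable_fun setT h -> (forall x, 0 <= h x) ->
    (forall x, ~ N x -> h x = g x) -> \int[mu]_x h x = \int[mu]_x g x.
  move=> mh h0 hg; apply: ge0_ae_eq_integral => //.
  exists N; split => // x /= hgx; apply: contrapT => /hg hgx'.
  by apply: hgx.
(* [lo] and [hi] take the extreme values on [N], so they enclose [f] there whatever it does; both
   are measurable and have the integral of [g]. *)
pose lo x := if x \in N then 0 else g x.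
pose hi x := if x \in N then +oo else g x.
have mlo : measurable_fun setT lo.
  by apply: measurable_fun_ifT => //; exact: measurable_fun_in.
have mhi : measurable_fun setT hi.
  by apply: measurable_fun_ifT => //; exact: measurable_fun_in.
apply/eqP; rewrite eq_le; apply/andP; split.
- rewrite -(eqN hi)//; first last.
  + by move=> x Nx; rewrite /hi memNset.
  + by move=> x; rewrite /hi; case: ifPn.
  apply: ge0_le_integralT => // x; rewrite /hi; case: ifPn => [_|].
    by rewrite leey.
  by rewrite notin_setE => /fg ->.
- rewrite -(eqN lo)//; first last.
  + by move=> x Nx; rewrite /lo memNset.
  + by move=> x; rewrite /lo; case: ifPn.
  apply: ge0_le_integralT => x; rewrite /lo; case: ifPn => //.
  by rewrite notin_setE => /fg ->.
Qed.

Import HBNNSimple.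

Lemma ge0_integral_density (nu : {measure set T -> \bar R}) (g f : T -> \bar R) :
  measurable_fun setT g -> (forall x, 0 <= g x) ->
  (forall A, measurable A -> nu A = \int[mu]_(x in A) g x) ->
  measurable_fun setT f -> (forall x, 0 <= f x) ->
  \int[nu]_x f x = \int[mu]_x (f x * g x).
Proof.
move=> mg g0 nuE mf f0.
pose h := nnsfun_approx measurableT mf.
have cvgh x : EFin (h n x) @[n --> \oo] --> f x by exact: cvg_nnsfun_approx.
have ndh x : nondecreasing_seq (fun n => (h n x)%:E).
  by move=> m n mn; rewrite lee_fin; exact/lefP/nd_nnsfun_approx.
have hsup x : f x = ereal_sup (range (fun n => (h n x)%:E)).
  by apply: cvg_unique (cvgh x) (ereal_nondecreasing_cvgn (ndh x)).
transitivity (limn (fun n => \int[nu]_x (h n x)%:E)).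
  rewrite -monotone_convergence//.
  - by apply: eq_integral => x _; apply/esym/cvg_lim.
  - by move=> n; exact/measurable_EFinP.
  - by move=> n x _; rewrite lee_fin.
transitivity (limn (fun n => \int[mu]_x ((h n x)%:E * g x))); last first.
  rewrite -monotone_convergence//.
  - apply: eq_integral => x _; apply/cvg_lim => //.
    have [gx|] := boolP (g x \is a fin_num).
      by apply: cvgeZr => //; exact: cvgh.
    (* Multiplication by [+oo] is not continuous at 0. If [f x] is 0, so is every approximant;
       otherwise the approximants are eventually positive and the products are constantly [+oo]. *)
    rewrite ge0_fin_numE// -leNgt leye_eq => /eqP gx.
    have [fx0|fx0] := eqVneq (f x) 0.
      rewrite fx0 mul0e; apply: cvg_near_cst; apply: nearW => n.
      suff : (h n x)%:E = 0 by move=> ->; rewrite mul0e.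
      apply/eqP; rewrite eq_le; apply/andP; split; last by rewrite lee_fin.
      by rewrite -fx0 hsup; apply: ereal_sup_ubound; exists n.
    have fxgt0 : 0 < f x by rewrite lt0e fx0 f0.
    rewrite gx gt0_muley//.
    apply: cvg_near_cst.
    have : \forall n \near \oo, 0 < (h n x)%:E.
      move: fxgt0; rewrite hsup => /ereal_sup_gt[_ [n _ <-] hn].
      by exists n => // m /= nm; apply: lt_le_trans hn (ndh x n m nm).
    by apply: filterS => n hn; rewrite gt0_muley.
  - by move=> n; apply: emeasurable_funM => //; exact/measurable_EFinP.
  - by move=> n x _; apply: mule_ge0 => //; rewrite lee_fin.
  - by move=> x _ m n mn; apply: lee_wpmul2r => //; exact: ndh.
congr (limn _); apply/funext => n.
under eq_integral do rewrite fimfunE -fsumEFin//.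
rewrite ge0_integral_fsum//; last 2 first.
  - by move=> r; exact/measurable_EFinP/measurableT_comp.
  - by move=> r x _; rewrite nnfun_muleindic_ge0.
under [RHS]eq_integral.
  move=> x _; rewrite fimfunE -fsumEFin// ge0_mule_fsuml; last first.
    by move=> r; rewrite nnfun_muleindic_ge0.
  over.
rewrite /= ge0_integral_fsum//; last 2 first.
  - move=> r; apply: emeasurable_funM => //.
    by apply/measurable_EFinP/measurableT_comp.
  - by move=> r x _; apply: mule_ge0 => //; rewrite nnfun_muleindic_ge0.
apply: eq_fsbigr => r /set_mem [x _ hx].
have mr : measurable (h n @^-1` [set r]) by [].
have r0 : (0 <= r)%R by rewrite -hx.
under eq_integral do rewrite EFinM.
under [RHS]eq_integral do rewrite EFinM -muleA.
rewrite !ge0_integralZl//; last 3 first.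
  - by apply: emeasurable_funM => //; exact/measurable_EFinP.
  - by move=> y _; apply: mule_ge0 => //; rewrite lee_fin.
  - exact/measurable_EFinP.
congr (_ * _); rewrite integral_indic// setIT nuE// integral_mkcond.
apply: eq_integral => y _; rewrite patchE indicE.
by case: ifPn => _; rewrite ?mul1e ?mul0e.
Qed.

End lower_integral.

Section image_measure.
Context d1 d2 (T1 : measurableType d1) (T2 : measurableType d2) (R : realType).
Variables (mu : {measure set T1 -> \bar R}) (f : T1 -> T2).
Hypothesis mf : measurable_fun setT f.

Definition image_measure : {measure set T2 -> \bar R} :=
  measure_function_pushforward__canonical__measure_function_Measure mu mf.

Lemma ge0_integral_image (g : T2 -> \bar R) :
  measurable_fun setT g -> (forall y, 0 <= g y)%E ->
  (\int[image_measure]_y g y = \int[mu]_x g (f x))%E.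
Proof.
by move=> mg g0; rewrite [LHS](@ge0_integral_pushforward _ _ _ _ _ _ mf).
Qed.

End image_measure.

Section real_line.
Context {R : realType}.
Local Notation leb := (@lebesgue_measure R).

Lemma measurable_invr : measurable_fun setT (@GRing.inv R).
Proof.
rewrite -(setUv [set 0%R : R]); apply/measurable_funU => //.
- exact: measurableC.
split; first exact: measurable_fun_set1.
apply: open_continuous_measurable_fun;
  first exact/closed_openC/accessible_closed_set1/hausdorff_accessible/Rhausdorff.
by move=> x /set_mem/= /eqP; exact: inv_continuous.
Qed.

Lemma lebesgue_measure_shift (a : R) (A : set R) : measurable A ->
  leb ((fun x => x + a) @^-1` A) = leb A.
Proof.
move=> mA; pose s (x : measurableTypeR R) : measurableTypeR R := x + a.
have ms : measurable_fun setT s by exact: measurable_funD.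
apply/esym/(@lebesgue_measure_unique R (image_measure leb ms)) => // X.
rewrite /ocitv => -[[u v] /= _ <-]; rewrite -[RHS]/(leb (s @^-1` _)) /s.
have -> : (fun x => x + a) @^-1` `]u, v] = `]u - a, v - a]%classic.
  by apply/seteqP; split => x /=; rewrite !in_itv/= ltrBlDr lerBrDr.
rewrite !lebesgue_measure_itv/= !lte_fin ltrD2r.
by case: ifPn => // _; rewrite -!EFinB; congr EFin; ring.
Qed.

(** The shift moves the window to [[a, p + a[], and periodicity brings the part beyond [p] back to
    [[0, a[]. This is what makes the offset between the lines of one point irrelevant. *)
Lemma lebesgue_measure_periodic (p a : R) (A : set R) : measurable A ->
  0 <= a <= p -> (forall x, A (x + p) <-> A x) ->
  leb ((fun x => x + a) @^-1` A `&` `[0, p[) = leb (A `&` `[0, p[).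
Proof.
move=> mA /andP[a0 ap] Ap.
have -> : (fun x => x + a) @^-1` A `&` `[0, p[ =
    (fun x => x + a) @^-1` (A `&` `[a, p + a[).
  by apply/seteqP; split => x /=; rewrite !in_itv/= lerDr ltrD2r.
rewrite lebesgue_measure_shift; last exact: measurableI.
have -> : A `&` `[a, p + a[ = (A `&` `[a, p[) `|` (A `&` `[p, p + a[).
  rewrite -setIUr; congr (_ `&` _); apply/seteqP; split => x /=.
    rewrite !in_itv/= => /andP[-> ->]/=; rewrite andbT.
    by have [?|?] := ltP x p; [left|right].
  rewrite !in_itv/= => -[|] /andP[? ?]; apply/andP; split; lra.
have -> : A `&` `[0, p[ = (A `&` `[0, a[) `|` (A `&` `[a, p[).
  rewrite -setIUr; congr (_ `&` _); apply/seteqP; split => x /=.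
    rewrite !in_itv/= => /andP[-> ->]/=; rewrite andbT.
    by have [?|?] := ltP x a; [left|right].
  rewrite !in_itv/= => -[|] /andP[? ?]; apply/andP; split; lra.
rewrite !measureU//; try exact: measurableI; last 2 first.
- rewrite -subset0 => x [[_ /=]]; rewrite in_itv/= => /andP[_ xa] [_ /=].
  by rewrite in_itv/= leNgt xa.
- rewrite -subset0 => x [[_ /=]]; rewrite in_itv/= => /andP[_ xa] [_ /=].
  by rewrite in_itv/= leNgt xa.
rewrite addeC; congr (_ + _)%E.
rewrite -[LHS](@lebesgue_measure_shift p); last exact: measurableI.
congr (leb _); apply/seteqP; split => x /=; rewrite !in_itv/= => -[? ?].
  by split; [exact/Ap|lra].
by split; [exact/Ap|lra].
Qed.

End real_line.

(** * Gaussian integrals *)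

Section calculus.
Context {R : realType}.
Local Notation leb := (@lebesgue_measure R).

Lemma continuous_is_derive (F f : R -> R) :
  (forall x : R, is_derive x 1 F (f x)) -> continuous F.
Proof.
by move=> dF x; apply: differentiable_continuous; apply/derivable1_diffP.
Qed.

Lemma FTC2_is_derive (F f : R -> R) (a b : R) : a < b -> continuous f ->
  (forall x : R, is_derive x 1 F (f x)) ->
  (\int[leb]_(x in `[a, b]) (f x)%:E = (F b)%:E - (F a)%:E)%E.
Proof.
move=> ab cf dF; have cF := continuous_is_derive dF.
apply: continuous_FTC2 => //; first exact: continuous_subspaceT.
- split; first by [].
  + exact/cvg_at_right_filter/cF.
  + exact/cvg_at_left_filter/cF.
- by move=> x _; rewrite derive1E derive_val.
Qed.

Lemma FTC2y_is_derive (F f : R -> R) (a l : R) :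
  continuous f -> (forall x, a <= x -> 0 <= f x) ->
  (forall x : R, is_derive x 1 F (f x)) -> F x @[x --> +oo] --> l ->
  (\int[leb]_(x in `[a, +oo[) (f x)%:E = l%:E - (F a)%:E)%E.
Proof.
move=> cf f0 dF Fl; have cF := continuous_is_derive dF.
apply: ge0_continuous_FTC2y => //; first exact: continuous_subspaceT.
- exact/cvg_at_right_filter/cF.
- by move=> x _; rewrite derive1E derive_val.
Qed.

Lemma is_derive_gauss (k : R) (x : R) :
  is_derive x 1 (fun t => expR (- (k * t ^+ 2)))
    (- (2 * k * x * expR (- (k * x ^+ 2)))).
Proof.
have H : is_derive x 1 (expR \o - (k *: (@id R ^+ 2)))
    (- (2 * k * x * expR (- (k * x ^+ 2)))).
  by apply: is_derive_eq; rewrite /GRing.scale/=; ring.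
exact: H.
Qed.

Lemma continuous_gauss (k : R) : continuous (fun t : R => expR (- (k * t ^+ 2))).
Proof. by apply: continuous_is_derive => x; exact: is_derive_gauss. Qed.

Lemma measurable_gauss (k : R) :
  measurable_fun setT (fun t : R => expR (- (k * t ^+ 2))).
Proof. by apply: continuous_measurable_fun; exact: continuous_gauss. Qed.

Lemma cvg_gauss (k : R) : 0 < k ->
  expR (- (k * t ^+ 2)) @[t --> +oo] --> (0 : R).
Proof.
move=> k0.
apply: (cvg_comp (fun t => k * t ^+ 2) (fun t => expR (- t)) _ (@cvgr_expR R)).
by apply: gt0_cvgMry => //; exact: cvgr_expr2.
Qed.

Lemma integral_gauss_tail (rho a : R) : 0 < rho -> 0 <= a ->
  (\int[leb]_(c in `[a, +oo[) (2 * c * expR (- (rho * c ^+ 2)))%:E =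
   (expR (- (rho * a ^+ 2)) / rho)%:E)%E.
Proof.
move=> rho0 a0.
pose F : R -> R := fun t => (- rho^-1) * expR (- (rho * t ^+ 2)).
have dF (c : R) : is_derive c 1 F (2 * c * expR (- (rho * c ^+ 2))).
  have H := is_derive_gauss rho c.
  have H2 : is_derive c 1 ((- rho^-1) *: (fun t : R => expR (- (rho * t ^+ 2))))
      (2 * c * expR (- (rho * c ^+ 2))).
    by apply: is_derive_eq; rewrite /GRing.scale/=; field; rewrite gt_eqF.
  exact: H2.
rewrite (@FTC2y_is_derive F _ a 0).
- by rewrite -EFinB sub0r /F mulNr opprK mulrC.
- by move=> c; apply: cvgM; [apply: cvgM; [exact: cvg_cst|exact: cvg_id]|
    exact: continuous_gauss].
- by move=> c ac; rewrite !mulr_ge0// ?expR_ge0// (le_trans a0).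
- rewrite /F -(mulr0 (- rho^-1)); apply: cvgM; first exact: cvg_cst.
  exact: cvg_gauss.
Qed.

Lemma integral_abs_gauss (k : R) : 0 < k ->
  (\int[leb]_y (`|y| * expR (- (k * y ^+ 2)))%:E = (k^-1)%:E)%E.
Proof.
move=> k0; pose f (y : R) := `|y| * expR (- (k * y ^+ 2)).
have cf : continuous f.
  by move=> y; apply: cvgM; [exact: cvg_norm|exact: continuous_gauss].
have mf : measurable_fun setT f by exact: continuous_measurable_fun.
rewrite -[LHS]/(\int[leb]_y (f y)%:E)%E ge0_symfun_integralT//.
- have := @integral_gauss_tail k 0 k0 (lexx _).
  rewrite expr0n mulr0 oppr0 expR0 div1r => <-.
  rewrite -set_itvcy -ge0_integralZl//.
  + apply: eq_integral => y /[!inE]/=; rewrite in_itv/= andbT => y0.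
    by rewrite -EFinM mulrA ger0_norm.
  + exact/measurable_EFinP/measurable_funTS.
  + by move=> y _; rewrite lee_fin mulr_ge0// expR_ge0.
- by move=> y; rewrite mulr_ge0// expR_ge0.
- by move=> y; rewrite /f /= normrN sqrrN.
Qed.

Lemma integral_inv_sqr_tail (a : R) : 0 < a ->
  (\int[leb]_(c in `[a, +oo[) (c ^- 2)%:E = (a^-1)%:E)%E.
Proof.
move=> a0.
have dF (x : R) : 0 < x -> is_derive x 1 (fun t : R => - t^-1) (x ^- 2).
  move=> x0; have H : is_derive x 1 (- (fun t : R => t^-1)) (x ^- 2).
    apply: is_derive_eq; first by apply: is_deriveN; apply: is_deriveV; rewrite gt_eqF.
    by rewrite /GRing.scale/=; field; rewrite gt_eqF.
  exact: H.
have cV (x : R) : 0 < x -> {for x, continuous (fun t : R => - t^-1)}.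
  by move=> x0; apply: cvgN; apply: inv_continuous; rewrite gt_eqF.
rewrite (@ge0_continuous_FTC2y _ _ (fun t => - t^-1) a 0).
- by rewrite -EFinB sub0r opprK.
- by move=> x ax; rewrite invr_ge0 sqr_ge0.
- apply: continuous_in_subspaceT => x /set_mem/=; rewrite in_itv/= andbT => ax.
  have x0 : x != 0 by rewrite gt_eqF// (lt_le_trans a0).
  by apply: cvgV; [rewrite expf_eq0|exact: exprn_continuous].
- rewrite -oppr0; apply: cvgN; apply/gtr0_cvgV0; last exact: cvg_id.
  exact: nbhs_pinfty_gt.
- by move=> x ax; have [] := dF x (lt_trans a0 ax).
- exact/cvg_at_right_filter/cV.
- move=> x; rewrite in_itv/= andbT => ax.
  by have H := dF x (lt_trans a0 ax); rewrite derive1E derive_val.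
Qed.

Lemma integral_gauss (c s : R) : 0 < c ->
  (\int[leb]_x (expR (- (c ^+ 2 * (x - s) ^+ 2)))%:E = (Num.sqrt pi / c)%:E)%E.
Proof.
(* The standard deviation for which the normal density of mean [s] has exponent
   [- (c ^+ 2 * (x - s) ^+ 2)]; its total mass 1 then gives the integral. *)
move=> c0; pose sg : R := (Num.sqrt 2 * c)^-1.
have s20 : 0 < Num.sqrt 2 :> R by rewrite sqrtr_gt0.
have sg0 : sg != 0 by rewrite invr_eq0 mulf_neq0// gt_eqF.
have sgE : sg ^+ 2 = (2 * c ^+ 2)^-1.
  by rewrite /sg exprVn exprMn sqr_sqrtr.
have c1 : c != 0 by rewrite gt_eqF.
have pkE : normal_peak sg = c / Num.sqrt pi.
  rewrite /normal_peak sgE (_ : _ *+ 2 = pi * (c^-1) ^+ 2); last by field.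
  rewrite sqrtrM ?pi_ge0// sqrtr_sqr ger0_norm ?invr_ge0 ?ltW//.
  by rewrite invfM invrK mulrC.
have pk0 : 0 < normal_peak sg by exact: normal_peak_gt0.
have := integral_normal_pdf s sg; rewrite (normal_pdfE _ sg0).
under eq_integral do rewrite EFinM.
rewrite ge0_integralZl//; last 3 first.
- by apply/measurable_EFinP; exact: measurable_normal_fun.
- by move=> x _; rewrite lee_fin normal_fun_ge0.
- by rewrite lee_fin ltW.
rewrite (_ : (\int[_]_x _ = \int[leb]_x (expR (- (c ^+ 2 * (x - s) ^+ 2)))%:E)%E);
  last first.
  apply: eq_integral => x _; rewrite /normal_fun sgE; congr (expR _)%:E.
  by field.
have pi0 : 0 < Num.sqrt pi :> R by rewrite sqrtr_gt0 pi_gt0.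
have k0 : 0 < c / Num.sqrt pi by rewrite divr_gt0.
rewrite pkE; case: (\int[leb]_x _)%E => [r| |].
- move=> [H]; congr EFin; apply: (mulfI (lt0r_neq0 k0)); rewrite H.
  by field; rewrite c1 gt_eqF.
- by rewrite gt0_muley// lte_fin.
- by rewrite gt0_muleNy// lte_fin.
Qed.

(** The factor [lam] is the intensity of points at [p]; the exponential is the probability that the
    disc about [(s, 0)] reaching to [p] is void. *)
Definition gauss_kernel (lam s : R) (p : R * R) : R :=
  lam * expR (- (lam * pi * sqdist p (s, 0))).

(* Up to the factor [pi^-1], the density at [s] of the abscissa where a uniformly
   oriented line through [x] meets the horizontal axis (a Cauchy density); it
   is 0 for [x] on the axis. *)
Definition crossing_density (x : R * R) (s : R) : R :=
  `|x.2| / (x.2 ^+ 2 + (s - x.1) ^+ 2).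

Lemma measurable_gauss_kernel (lam s : R) :
  measurable_fun setT (gauss_kernel lam s).
Proof.
apply: measurable_funM => //; apply: measurableT_comp => //.
apply: measurableT_comp => //; apply: measurable_funM => //.
rewrite /sqdist; apply: measurable_funD => //; apply: measurable_funX;
  by apply: measurable_funB.
Qed.

Lemma measurable_crossing_density :
  measurable_fun setT (fun z : (R * R) * R => crossing_density z.1 z.2).
Proof.
have m11 : measurable_fun setT (fun z : (R * R) * R => z.1.1).
  by apply: measurableT_comp.
have m12 : measurable_fun setT (fun z : (R * R) * R => z.1.2).
  by apply: measurableT_comp.
apply: measurable_funM; first exact: measurableT_comp.
apply: (measurableT_comp measurable_invr); apply: measurable_funD => //;
  by apply: measurable_funX => //; apply: measurable_funB.
Qed.

Lemma measurable_plane_gauss (h : R -> R) (k s : R) : measurable_fun setT h ->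
  measurable_fun setT
    (fun p : R * R => (h p.2 * expR (- (k * sqdist p (s, 0))))%:E).
Proof.
move=> mh; apply/measurable_EFinP/measurable_funM; first exact: measurableT_comp.
apply: measurableT_comp => //; apply: measurableT_comp => //.
apply: measurable_funM => //; apply: measurable_funD; apply: measurable_funX;
  by apply: measurable_funB.
Qed.

(** The weight depends on the ordinate alone, so the Gaussian splits and the abscissa integrates
    explicitly. A constant [h] gives the mass of the kernel, the absolute value gives the crossing
    density. *)
Lemma integral_plane_gauss (h : R -> R) (c s : R) : 0 < c ->
  measurable_fun setT h -> (forall y, 0 <= h y) ->
  (\int[leb \x leb]_p (h p.2 * expR (- (c ^+ 2 * sqdist p (s, 0))))%:E =
   (Num.sqrt pi / c)%:E * \int[leb]_y (h y * expR (- (c ^+ 2 * y ^+ 2)))%:E)%E.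
Proof.
move=> c0 mh h0.
have mg (a : R) : measurable_fun setT (fun x : R => expR (- (c ^+ 2 * (x - a) ^+ 2))).
  apply: measurableT_comp => //; apply: measurableT_comp => //.
  by apply: measurable_funM => //; apply: measurable_funX; exact: measurable_funB.
have mf := @measurable_plane_gauss h (c ^+ 2) s mh.
rewrite fubini_tonelli2//; last first.
  by move=> p; rewrite lee_fin mulr_ge0// expR_ge0.
rewrite -ge0_integralZl//; last 3 first.
- apply/measurable_EFinP/measurable_funM => //.
  by have := mg 0; under eq_fun do rewrite subr0.
- by move=> y _; rewrite lee_fin mulr_ge0// expR_ge0.
- by rewrite lee_fin divr_ge0 ?sqrtr_ge0// ltW.
apply: eq_integral => y _; rewrite /fubini_G/=.
transitivity (\int[leb]_x ((h y * expR (- (c ^+ 2 * y ^+ 2)))%:E *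
    (expR (- (c ^+ 2 * (x - s) ^+ 2)))%:E))%E.
  apply: eq_integral => x _; rewrite -EFinM -[in RHS]mulrA -expRD /sqdist/= subr0.
  by congr (_ * expR _)%:E; ring.
rewrite ge0_integralZl//; last 2 first.
- by apply/measurable_EFinP; exact: mg.
- by rewrite lee_fin mulr_ge0// expR_ge0.
by rewrite integral_gauss// muleC.
Qed.

Lemma gauss_kernel_mass (lam s : R) : 0 < lam ->
  (\int[leb \x leb]_p (gauss_kernel lam s p)%:E = 1)%E.
Proof.
move=> l0; have lp0 : 0 < lam * pi by rewrite mulr_gt0 ?pi_gt0.
have c0 : 0 < Num.sqrt (lam * pi) by rewrite sqrtr_gt0.
have c2 : Num.sqrt (lam * pi) ^+ 2 = lam * pi by rewrite sqr_sqrtr// ltW.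
have := @integral_plane_gauss (cst lam) _ s c0.
rewrite c2 => ->//=; last by move=> y; exact: ltW.
under eq_integral do rewrite EFinM.
rewrite ge0_integralZl//; last 2 first.
- apply/measurable_EFinP.
  exact: measurable_gauss.
- by rewrite lee_fin ltW.
have -> : (\int[leb]_x (expR (- (lam * pi * x ^+ 2)))%:E =
    (Num.sqrt pi / Num.sqrt (lam * pi))%:E)%E.
  by rewrite -(integral_gauss 0 c0) c2; apply: eq_integral => x _; rewrite subr0.
rewrite -!EFinM; congr EFin.
have p0 : 0 < pi :> R by exact: pi_gt0.
have -> : forall a b : R, b != 0 -> a / b * (lam * (a / b)) = lam * a ^+ 2 / b ^+ 2.
  by move=> a b b0; field.
  by rewrite sqr_sqrtr ?pi_ge0// c2 divff// gt_eqF.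
by rewrite gt_eqF.
Qed.

Lemma sigma_finite_plane : sigma_finite setT (leb \x leb)%E.
Proof.
have lebn n : (leb `[(- n%:R)%R, n%:R%R] < +oo)%E.
  by rewrite lebesgue_measure_itv/=; case: ifPn => _; rewrite ltry.
exists (fun n => `[- n%:R, n%:R] `*` `[- n%:R, n%:R]).
  apply/seteqP; split => // -[x y] _.
  exists (maxn (Num.bound `|x|) (Num.bound `|y|)) => //; split => /=;
    rewrite in_itv/= -ler_norml; apply: ltW; apply: lt_le_trans.
  - exact: archi_boundP.
  - by rewrite ler_nat leq_maxl.
  - exact: archi_boundP.
  - by rewrite ler_nat leq_maxr.
move=> n; split; first exact: measurableX.
rewrite product_measure1E//; apply: lte_mul_pinfty => //; last exact: lebn.
by rewrite ge0_fin_numE//; exact: lebn.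
Qed.

(** Bundled as a sigma-finite measure so that the plane can be one factor of a further product in
    Tonelli's theorem. *)
Definition plane :
    {sigma_finite_measure set (measurableTypeR R * measurableTypeR R)%type -> \bar R} :=
  HB.pack (leb \x leb)%E
    (Measure_isSigmaFinite.Build _ _ _ (leb \x leb)%E sigma_finite_plane).

(* Since [expR (- (a ^+ 2 * rho)) / rho] is the integral over [c >= a] of
   [2 * c * expR (- (c ^+ 2 * rho))], Tonelli reduces everything to Gaussian
   integrals, without polar coordinates. *)
Lemma crossing_density_gauss (lam s : R) : 0 < lam ->
  (\int[leb \x leb]_p ((crossing_density p s)%:E * (gauss_kernel lam s p)%:E) =
   (2 * Num.sqrt lam)%:E)%E.
Proof.
move=> l0; have lp0 : 0 < lam * pi by rewrite mulr_gt0 ?pi_gt0.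
(* With this lower limit, [expR (- (a ^+ 2 * rho))] is the exponential in [gauss_kernel]. *)
pose a := Num.sqrt (lam * pi).
have a0 : 0 < a by rewrite sqrtr_gt0.
have a2 : a ^+ 2 = lam * pi by rewrite sqr_sqrtr// ltW.
(* The absolute value of [z.2] agrees with [z.2] where the indicator is 1, and keeps [f] nonnegative
   everywhere, as Tonelli requires. *)
pose f (z : (R * R) * R) : \bar R :=
  (lam * (`|z.1.2| * (2 * `|z.2|)) * expR (- (z.2 ^+ 2 * sqdist z.1 (s, 0))) *
   \1_`[a, +oo[ z.2)%:E.
have f0 z : (0 <= f z)%E.
  by rewrite lee_fin !mulr_ge0// ?expR_ge0// ltW.
have mf : measurable_fun setT f.
  have m11 : measurable_fun setT (fun z : (R * R) * R => z.1.1).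
    by apply: measurableT_comp.
  have m12 : measurable_fun setT (fun z : (R * R) * R => z.1.2).
    by apply: measurableT_comp.
  apply/measurable_EFinP/measurable_funM; last first.
    have mi : measurable_fun setT (\1_`[a, +oo[ : R -> R) by exact: measurable_indic.
    exact: (measurableT_comp mi).
  apply: measurable_funM.
    apply: measurable_funM => //; apply: measurable_funM.
      exact: measurableT_comp.
    by apply: measurable_funM => //; exact: measurableT_comp.
  apply: measurableT_comp => //; apply: measurableT_comp => //.
  apply: measurable_funM; first exact: measurable_funX.
  by apply: measurable_funD; apply: measurable_funX; exact: measurable_funB.
transitivity (\int[leb \x leb]_p \int[leb]_c f (p, c))%E.
  apply: eq_integral => -[x y] _; rewrite /crossing_density /gauss_kernel /=.
  pose rho := sqdist (x, y) (s, 0).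
  have [->|y0] := eqVneq y 0.
    rewrite normr0 mul0r mul0e; under eq_integral.
      by move=> c _; rewrite /f /= normr0 !(mul0r, mulr0); over.
    by rewrite integral0.
  have rho0 : 0 < rho.
    rewrite /rho /sqdist /= subr0 ltr_wpDl ?sqr_ge0//.
    by rewrite exprn_even_gt0.
  transitivity (\int[leb]_(c in `[a, +oo[)
      ((lam * `|y|)%:E * (2 * c * expR (- (rho * c ^+ 2)))%:E))%E.
    rewrite ge0_integralZl//; last 3 first.
    + apply/measurable_EFinP/measurable_funTS.
      by apply: measurable_funM; [exact: measurable_funM|exact: measurable_gauss].
    + move=> c /=; rewrite in_itv/= andbT => ac.
      by rewrite lee_fin !mulr_ge0 ?expR_ge0// (le_trans _ ac)// ltW.
    + by rewrite lee_fin mulr_ge0// ltW.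
    rewrite integral_gauss_tail// ?ltW// -!EFinM; congr EFin.
    rewrite a2 (mulrC _ rho) -/rho.
    have -> : y ^+ 2 + (s - x) ^+ 2 = rho by rewrite /rho /sqdist/=; ring.
    by field; rewrite gt_eqF.
  rewrite integral_mkcond; apply: eq_integral => c _; rewrite patchE /f /= indicE.
  case: ifPn => [|_]; last by rewrite mulr0.
  rewrite inE/= in_itv/= andbT => ac; rewrite -EFinM; congr EFin.
  rewrite (ger0_norm (le_trans (ltW a0) ac)) (mulrC rho) -/rho; ring.
rewrite (@fubini_tonelli _ _ _ _ _ plane leb f)//.
(* At fixed [c] the plane integral is [lam * (2 * c)] times [Num.sqrt pi / c] from the abscissa
   times [c ^- 2] from the ordinate. *)
transitivity (\int[leb]_(c in `[a, +oo[) ((2 * lam * Num.sqrt pi)%:E * (c ^- 2)%:E))%E.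
  rewrite [RHS]integral_mkcond; apply: eq_integral => c _.
  rewrite patchE; case: ifPn => [|ac]; last first.
    by under eq_integral do rewrite /f /= indicE (negbTE ac) mulr0;
      rewrite integral0.
  rewrite inE/= in_itv/= andbT => ac; have c0 := lt_le_trans a0 ac.
  transitivity (\int[leb \x leb]_p ((lam * (2 * c))%:E *
      (`|p.2| * expR (- (c ^+ 2 * sqdist p (s, 0))))%:E))%E.
    apply: eq_integral => p _; rewrite /f /= indicE mem_set/=; last first.
      by rewrite in_itv/= ac.
    by rewrite -EFinM (ger0_norm (ltW c0)); congr EFin; ring.
  rewrite ge0_integralZl//; last 2 first.
  - exact: (@measurable_plane_gauss (fun y => `|y|)).
  - by rewrite lee_fin !mulr_ge0// ltW.
  rewrite (@integral_plane_gauss (fun y => `|y|))// integral_abs_gauss ?exprn_gt0//.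
  by rewrite -!EFinM; congr EFin; field; rewrite gt_eqF.
rewrite ge0_integralZl//; last 3 first.
- apply/measurable_EFinP/measurable_funTS.
  by apply: (measurableT_comp measurable_invr); exact: measurable_funX.
- by move=> c _; rewrite lee_fin invr_ge0 sqr_ge0.
- by rewrite lee_fin !mulr_ge0// ?sqrtr_ge0// ltW.
rewrite integral_inv_sqr_tail// -EFinM; congr EFin.
rewrite /a sqrtrM ?ltW// -[X in 2 * X](sqr_sqrtr (ltW l0)).
by field; rewrite !gt_eqF// sqrtr_gt0// pi_gt0.
Qed.

End calculus.

Lemma measurable_preimage d d' (T : measurableType d) (U : measurableType d')
  (f : T -> U) (B : set U) :
  measurable_fun setT f -> measurable B -> measurable (f @^-1` B).
Proof. by move=> mf mB; rewrite -[X in measurable X]setTI; exact: mf. Qed.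

Section density_measure.
Local Open Scope ereal_scope.
Context d (T : measurableType d) (R : realType).
Variables (mu : {measure set T -> \bar R}) (f : T -> \bar R).
Hypotheses (mf : measurable_fun setT f) (f0 : forall x, 0 <= f x).

Let dens (A : set T) : \bar R := \int[mu]_(x in A) f x.

Let dens0 : dens set0 = 0. Proof. exact: integral_set0. Qed.

Let dens_ge0 A : 0 <= dens A. Proof. exact: integral_ge0. Qed.

Let dens_sigma_additive : semi_sigma_additive dens.
Proof.
move=> F mF tF mUF; rewrite /dens; apply: cvg_toP.
  apply: ereal_nondecreasing_is_cvgn => m n mn.
  by apply: lee_sum_nneg_natr => // k _ _; exact: integral_ge0.
by rewrite ge0_integral_bigcup//; exact: measurable_funTS.
Qed.

Definition density_measure : {measure set T -> \bar R} :=
  HB.pack dens (isMeasure.Build _ _ _ dens dens0 dens_ge0 dens_sigma_additive).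

Lemma density_measureE A : density_measure A = \int[mu]_(x in A) f x.
Proof. by []. Qed.

End density_measure.

(** * Discs, lines and Poisson sums *)

Section geometry.
Context {R : realType}.
Local Notation leb := (@lebesgue_measure R).

Lemma lebesgue_measure_sqr_lt (u : R) :
  leb [set y | y ^+ 2 < u] = (2 * Num.sqrt u)%:E.
Proof.
have [u0|u0] := leP u 0.
  rewrite ler0_sqrtr// mulr0 (_ : [set y | _] = set0) ?measure0//.
  by rewrite -subset0 => y /= /lt_le_trans /(_ u0); rewrite ltNge sqr_ge0.
have -> : [set y | y ^+ 2 < u] = `](- Num.sqrt u)%R, Num.sqrt u[%classic.
  by apply/seteqP; split => y /=; rewrite in_itv/= -ltr_norml -sqrtr_sqr ltr_sqrt.
rewrite lebesgue_measure_itv/= lte_fin gt0_cp// ?sqrtr_gt0//.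
by rewrite -EFinB; congr EFin; ring.
Qed.

(** The substitution [x = s + r * sin u] turns the chord length into [2 * (r * cos u)], and
    [u + sin u * cos u] is a primitive of [2 * cos u ^+ 2]. *)
Lemma integral_half_disc (s r : R) : 0 < r ->
  (\int[leb]_(x in `[(s - r)%R, (s + r)%R]) (2 * Num.sqrt (r ^+ 2 - (x - s) ^+ 2))%:E =
   (pi * r ^+ 2)%:E)%E.
Proof.
move=> r0; pose F (u : R) : R := s + r * sin u.
pose G (x : R) : R := 2 * Num.sqrt (r ^+ 2 - (x - s) ^+ 2).
have p20 : 0 < pi / 2 :> R by rewrite divr_gt0 ?pi_gt0.
have Fa : F (- (pi / 2)) = s - r by rewrite /F sinN sin_pihalf; ring.
have Fb : F (pi / 2) = s + r by rewrite /F sin_pihalf; ring.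
have dF (u : R) : is_derive u 1 F (r * cos u).
  rewrite -[r * cos u]add0r.
  exact: (is_deriveD (is_derive_cst s u 1) (is_deriveZ r (is_derive_sin u))).
have F'E : F^`()%classic = (fun u => r * cos u).
  by apply/funext => u; rewrite derive1E derive_val.
have cF : continuous F by exact: continuous_is_derive dF.
have cF' : continuous (fun u : R => r * cos u).
  by move=> u; apply: cvgM; [exact: cvg_cst|exact: continuous_cos].
have cG : continuous G.
  move=> x; apply: cvgM; first exact: cvg_cst.
  apply: (cvg_comp (fun x => r ^+ 2 - (x - s) ^+ 2) Num.sqrt); last first.
    exact: sqrt_continuous.
  apply: cvgB; first exact: cvg_cst.
  apply: (cvg_comp (fun x => x - s) (fun x => x ^+ 2)).
    by apply: cvgB; [exact: cvg_id|exact: cvg_cst].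
  exact: exprn_continuous.
rewrite -Fa -Fb (@integration_by_substitution_increasing _ F G).
- transitivity (\int[leb]_(u in `[(- (pi / 2))%R, (pi / 2)%R])
      (r ^+ 2 * (2 * cos u ^+ 2))%:E)%E.
    apply: eq_integral => u; rewrite inE/= in_itv/= => /andP[u1 u2].
    rewrite F'E /G /F /=; congr EFin.
    have cu : 0 <= cos u by rewrite cos_ge0_pihalf// u1.
    rewrite -[LHS]/(2 * Num.sqrt (r ^+ 2 - (s + r * sin u - s) ^+ 2) * (r * cos u)).
    have -> : r ^+ 2 - (s + r * sin u - s) ^+ 2 = (r * cos u) ^+ 2.
      by rewrite -(mulr1 (r ^+ 2)) -(cos2Dsin2 u); ring.
    rewrite sqrtr_sqr ger0_norm ?mulr_ge0// ?ltW//.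
    by ring.
  have dH (u : R) : is_derive u 1 (fun u => r ^+ 2 * (u + sin u * cos u))
      (r ^+ 2 * (2 * cos u ^+ 2)).
    have := is_deriveZ (r ^+ 2) (is_deriveD (is_derive_id u 1)
      (is_deriveM (is_derive_sin u) (is_derive_cos u))).
    move=> /is_derive_eq; apply; rewrite /GRing.scale/=; congr (_ * _).
    by have := cos2Dsin2 u; rewrite !expr2; lra.
  rewrite (@FTC2_is_derive _ (fun u => r ^+ 2 * (u + sin u * cos u))).
  + rewrite cosN sinN cos_pihalf sin_pihalf -EFinB; congr EFin; lra.
  + lra.
  + move=> u; apply: cvgM; first exact: cvg_cst.
    apply: cvgM; first exact: cvg_cst.
    by apply: (cvg_comp (@cos R) (fun x => x ^+ 2));
      [exact: continuous_cos|exact: exprn_continuous].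
- lra.
- move=> u w uI wI uw; rewrite /F ltrD2l ltr_pM2l//.
  by rewrite ltr_sin.
- by rewrite F'E => u _; exact: cF'.
- rewrite F'E; apply: cvgP; apply: cvg_at_right_filter; exact: cF'.
- rewrite F'E; apply: cvgP; apply: cvg_at_left_filter; exact: cF'.
- split; first by [].
  + exact/cvg_at_right_filter/cF.
  + exact/cvg_at_left_filter/cF.
- exact: continuous_subspaceT.
Qed.

Lemma area_disc (s t : R) : 0 <= t ->
  area [set p | sqdist p (s, 0) < t] = (pi * t)%:E.
Proof.
move=> t0; rewrite /area /product_measure1.
(* Vertical slices. [Num.sqrt] is 0 on negative numbers, so the chord formula also holds for the
   empty slices outside the disc. *)
transitivity (\int[leb]_x (2 * Num.sqrt (t - (x - s) ^+ 2))%:E)%E.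
  apply: eq_integral => x _ /=; rewrite -lebesgue_measure_sqr_lt.
  congr (leb _); apply/seteqP; split => y /=.
    by move/set_mem; rewrite /sqdist /= subr0 addrC ltrBrDr.
  by move=> yt; apply/mem_set; rewrite /sqdist/= subr0 addrC -ltrBrDr.
move: t0; rewrite le_eqVlt => /predU1P[<-|t0].
  rewrite mulr0; apply: integral0_eq => x _.
  by rewrite ler0_sqrtr ?mulr0// sub0r oppr_le0 sqr_ge0.
have t2 : Num.sqrt t ^+ 2 = t by rewrite sqr_sqrtr// ltW.
rewrite -[in RHS]t2 -(@integral_half_disc s) ?sqrtr_gt0// t2.
rewrite [RHS]integral_mkcond; apply: eq_integral => x _; rewrite patchE.
case: ifPn => // /negP; rewrite inE/= in_itv/= => xI.
rewrite ler0_sqrtr ?mulr0// leNgt; apply/negP => xt; apply: xI.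
rewrite -ler_distl -sqrtr_sqr ler_sqrt ?ltW//.
by rewrite -subr_gt0.
Qed.

(* Abscissa where the line through [x] of direction [phi] meets the horizontal
   axis; the junk value [x.1] when the line is horizontal, [sin phi = 0]. *)
Definition crossing (x : R * R) (phi : R) : R := x.1 - x.2 * (cos phi / sin phi).

Lemma measurable_crossing d (T : measurableType d) (f : T -> R * R) (g : T -> R) :
  measurable_fun setT f -> measurable_fun setT g ->
  measurable_fun setT (fun t => crossing (f t) (g t)).
Proof.
move=> mf mg; have msin : measurable_fun setT (@sin R).
  by apply: continuous_measurable_fun; exact: continuous_sin.
have mcos : measurable_fun setT (@cos R).
  by apply: continuous_measurable_fun; exact: continuous_cos.
apply: measurable_funB; first exact: measurableT_comp.
apply: measurable_funM; first exact: measurableT_comp.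
apply: measurable_funM; first exact: (measurableT_comp mcos).
exact: (measurableT_comp measurable_invr (measurableT_comp msin mg)).
Qed.

Lemma ltr_atan : {mono (@atan R) : x y / x < y}.
Proof. exact/leW_mono/le_mono/lt_atan. Qed.

(** The angle [pi / 2 - phi] lies in the range of [atan] and its tangent is the cotangent of [phi].
    Comparisons of cotangents thereby become comparisons of angles. *)
Lemma cot_tan (phi : R) : 0 < phi < pi ->
  pi / 2 - phi = atan (cos phi / sin phi).
Proof.
move=> /andP[p0 pp]; rewrite -[LHS]tanK ?in_itv/=; last by apply/andP; split; lra.
rewrite /tan; congr (atan (_ / _)).
  by rewrite -opprB sinN sinBpihalf opprK.
by rewrite -opprB cosN cosBpihalf.
Qed.

Lemma ltr_cot (phi c : R) : 0 < phi < pi ->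
  (c < cos phi / sin phi) = (phi < pi / 2 - atan c).
Proof.
by move=> p; rewrite -ltr_atan -cot_tan// ltrBrDr addrC -ltrBrDr.
Qed.

Lemma ler_cot (phi c : R) : 0 < phi < pi ->
  (c <= cos phi / sin phi) = (phi <= pi / 2 - atan c).
Proof.
move=> p; rewrite -(le_mono (@lt_atan R)) -cot_tan//.
by rewrite lerBrDr addrC -lerBrDr.
Qed.

(** The cotangent decreases on []0, pi[], so [crossing x] is monotone there and the preimage is an
    interval. It increases when [x.2] is positive and decreases when [x.2] is negative, which swaps
    the closed end; the oddness of [atan] reconciles the two lengths. *)
Lemma crossing_itv (x : R * R) (a b : R) : x.2 != 0 -> a < b ->
  leb (crossing x @^-1` `]a, b] `&` `]0, pi[) =
  (atan ((b - x.1) / `|x.2|) - atan ((a - x.1) / `|x.2|))%:E.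
Proof.
case: x => x y /= y0 ab; rewrite /crossing/=.
have atB (c : R) : - (pi / 2) < atan c < pi / 2.
  by rewrite atan_gtNpi2 atan_ltpi2.
have lebI (u w : R) (b0 b1 : bool) : u <= w ->
    leb [set` Interval (BSide b0 u) (BSide b1 w)] = (w - u)%:E.
  rewrite lebesgue_measure_itv/= lte_fin le_eqVlt => /predU1P[->|->].
    by rewrite ltxx subrr.
  by rewrite EFinB.
have [yp|yn|/eqP] := ltgtP 0 y; last by rewrite eq_sym (negbTE y0).
- pose A := atan ((x - b) / y); pose B := atan ((x - a) / y).
  have AB : A < B by rewrite ltr_atan ltr_pM2r ?invr_gt0// ltrD2l ltrN2.
  rewrite (_ : _ `&` _ = `](pi / 2 - B)%R, (pi / 2 - A)%R]%classic).
    rewrite lebI; last by rewrite lerD2l lerN2 ltW.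
    congr EFin; rewrite /A /B gtr0_norm// -(opprB b x) -(opprB a x) !mulNr !atanN; lra.
  have /andP[A1 A2] := atB ((x - b) / y); have /andP[B1 B2] := atB ((x - a) / y).
  rewrite -/A -/B in A1 A2 B1 B2.
  have key phi : 0 < phi < pi -> (a < x - y * (cos phi / sin phi) <= b) =
      (pi / 2 - B < phi <= pi / 2 - A).
    move=> p; have e1 := ler_cot ((x - b) / y) p; have e2 := ler_cot ((x - a) / y) p.
    rewrite -/A in e1; rewrite -/B in e2; congr (_ && _).
      by rewrite [RHS]ltNge -e2 -ltNge ltr_pdivlMr//; apply/idP/idP; lra.
    by rewrite -e1 ler_pdivrMr//; apply/idP/idP; lra.
  apply/seteqP; split => phi /=; rewrite !in_itv/=.
    by move=> [+ p]; rewrite key.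
  move=> h; have p : 0 < phi < pi by apply/andP; split; lra.
  by rewrite key.
- pose A := atan ((x - a) / y); pose B := atan ((x - b) / y).
  have AB : A < B by rewrite ltr_atan ltr_nM2r ?invr_lt0// ltrD2l ltrN2.
  rewrite (_ : _ `&` _ = `[(pi / 2 - B)%R, (pi / 2 - A)%R[%classic).
    rewrite lebI; last by rewrite lerD2l lerN2 ltW.
    congr EFin; rewrite /A /B ltr0_norm// -(opprB x b) -(opprB x a) !invrN !mulrNN; lra.
  have /andP[A1 A2] := atB ((x - a) / y); have /andP[B1 B2] := atB ((x - b) / y).
  rewrite -/A -/B in A1 A2 B1 B2.
  have key phi : 0 < phi < pi -> (a < x - y * (cos phi / sin phi) <= b) =
      (pi / 2 - B <= phi < pi / 2 - A).
    move=> p; have e1 := ltr_cot ((x - a) / y) p; have e2 := ltr_cot ((x - b) / y) p.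
    rewrite -/A in e1; rewrite -/B in e2; rewrite [RHS]andbC; congr (_ && _).
      by rewrite -e1 ltr_ndivrMr//; apply/idP/idP; lra.
    by rewrite [RHS]leNgt -e2 -leNgt ler_ndivlMr//; apply/idP/idP; lra.
  apply/seteqP; split => phi /=; rewrite !in_itv/=.
    by move=> [+ p]; rewrite key.
  move=> h; have p : 0 < phi < pi by apply/andP; split; lra.
  by rewrite key.
Qed.

Lemma integral_crossing_density_itv (x : R * R) (a b : R) : x.2 != 0 -> a < b ->
  (\int[leb]_(s in `]a, b]) (crossing_density x s)%:E =
  (atan ((b - x.1) / `|x.2|) - atan ((a - x.1) / `|x.2|))%:E)%E.
Proof.
case: x => x y /= y0 ab; have n0 : 0 < `|y| by rewrite normr_gt0.
have r0 (s : R) : y ^+ 2 + (s - x) ^+ 2 != 0.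
  by rewrite gt_eqF// ltr_pwDl ?sqr_ge0// exprn_even_gt0.
have cr : continuous (crossing_density (x, y)).
  move=> s; apply: cvgM; first exact: cvg_cst.
  apply: cvgV => //=; apply: cvgD; first exact: cvg_cst.
  apply: (cvg_comp (fun s => s - x) (fun s => s ^+ 2)).
    by apply: cvgB; [exact: cvg_id|exact: cvg_cst].
  exact: exprn_continuous.
have dF (s : R) : is_derive s 1 (fun s => atan ((s - x) / `|y|))
    (crossing_density (x, y) s).
  have dg : is_derive s 1 (`|y|^-1 *: (@id R - cst x)) (`|y|^-1 *: (1 - 0)).
    exact: (is_deriveZ _ (is_deriveB (is_derive_id s 1) (is_derive_cst x s 1))).
  have gE : `|y|^-1 *: (@id R - cst x) = (fun s => (s - x) / `|y|).
    by apply/funext => t; rewrite mulrC.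
  rewrite gE in dg; have := @is_derive1_comp R _ (fun s => (s - x) / `|y|) _ _ _
    (is_derive1_atan ((s - x) / `|y|)) dg.
  move=> /is_derive_eq; apply;
    rewrite subr0 /crossing_density/= -[y ^+ 2]real_normK ?num_real//.
  have := r0 s; rewrite -[y ^+ 2]real_normK ?num_real// => r0s.
  have ny : `|y| != 0 by rewrite gt_eqF.
  rewrite /GRing.scale/=; field.
  by rewrite ny r0s.
rewrite integral_itv_obnd_cbnd; last first.
  apply/measurable_EFinP/measurable_funTS.
  by have := continuous_measurable_fun cr.
by rewrite (FTC2_is_derive ab cr dF) EFinB.
Qed.

(** Both sides are measures in [A] that agree on half-open intervals, and the restriction to []0,
    pi[] makes the first one finite. *)
Lemma crossing_law (x : R * R) (A : set R) : x.2 != 0 -> measurable A ->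
  leb (crossing x @^-1` A `&` `]0, pi[) =
  (\int[leb]_(s in A) (crossing_density x s)%:E)%E.
Proof.
move=> x0 mA.
have mcr : measurable_fun setT (crossing x : measurableTypeR R -> measurableTypeR R).
  exact: (@measurable_crossing _ _ (cst x) id).
have md : measurable_fun setT (fun s : measurableTypeR R => (crossing_density x s)%:E).
  apply/measurable_EFinP.
  exact: (measurableT_comp measurable_crossing_density (@pair1_measurable _ _ _ _ x)).
have d0 (s : measurableTypeR R) : (0 <= (crossing_density x s)%:E)%E.
  by rewrite lee_fin divr_ge0// addr_ge0// sqr_ge0.
have mI : measurable (`]0, pi[ : set (measurableTypeR R)) by exact: measurable_itv.
pose m1 := image_measure (mrestr leb mI) mcr.
pose m2 := density_measure leb md d0.
rewrite -[LHS]/(m1 A) -[RHS]/(m2 A).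
have m12 X : ocitv X -> m1 X = m2 X.
  move=> /ocitvP[->|[[a b] /= ab ->]]; first by rewrite !measure0.
  rewrite -[LHS]/(leb (crossing x @^-1` `]a, b] `&` `]0, pi[)) crossing_itv//.
  by rewrite integral_crossing_density_itv.
apply: (@measure_unique _ R (measurableTypeR R) (@ocitv R)
  (fun n => `](- n%:R)%R, n%:R%R]%classic) _ _ _ _ m1 m2) => //.
- exact: ocitvI.
- by move=> n; exact: is_ocitv.
- apply/seteqP; split => // y _.
  exists (Num.bound `|y|).+1 => //=; rewrite in_itv/=.
  have := archi_boundP (normr_ge0 y); rewrite ltr_norml => /andP[y1 y2].
  rewrite -natr1; apply/andP; split; lra.
- move=> n; apply: (@le_lt_trans _ _ (leb `]0, pi[)).
    rewrite -[leLHS]/(leb (crossing x @^-1` _ `&` _)).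
    apply: le_measure; rewrite ?inE//; apply: measurableI => //.
    exact: (measurable_preimage mcr).
  by rewrite lebesgue_measure_itv/=; case: ifPn => _; rewrite -?EFinB ltry.
Qed.

Lemma poisson_law_ge0 (m : R) k : 0 <= m -> 0 <= poisson_law m k.
Proof. by move=> m0; rewrite /poisson_law mulr_ge0 ?expR_ge0// divr_ge0// exprn_ge0. Qed.

Lemma poisson_law_sum (m : R) : 0 <= m ->
  (\sum_(k <oo) (poisson_law m k)%:E = 1)%E.
Proof.
move=> m0; under eq_eseriesr do rewrite /poisson_law mulrC EFinM.
rewrite nneseriesZl/=; last by move=> n _; rewrite lee_fin divr_ge0// exprn_ge0.
rewrite [RHS](_ : _ = (expR (- m))%:E * (expR m)%:E)%E; last first.
  by rewrite -EFinM expRN mulVf// gt_eqF// expR_gt0.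
congr *%E; rewrite expRE -EFin_lim; last first.
  rewrite /pseries/=; under eq_fun do rewrite mulrC.
  exact: is_cvg_series_exp_coeff.
apply/congr_lim/funext => n/=; rewrite /pseries/= /series/= -sumEFin//.
by under eq_bigr do rewrite mulrC.
Qed.

(** Multiplying the mass at [k.+1] by [k.+1] gives [m] times the mass at [k], so an index shift
    reduces the mean to the total mass. *)
Lemma poisson_law_mean (m : R) : 0 <= m ->
  (\sum_(k <oo) (k%:R * poisson_law m k)%:E = m%:E)%E.
Proof.
move=> m0; rewrite nneseries_recl//=; last first.
  by move=> k _; rewrite lee_fin mulr_ge0// poisson_law_ge0.
rewrite mul0r add0e -[RHS]mule1 -(poisson_law_sum m0) -nneseriesZl//; last first.
  by move=> k _; rewrite lee_fin poisson_law_ge0.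
rewrite -(@nneseries_addn _ _ 1)//=; last first.
  by move=> k; rewrite lee_fin mulr_ge0// poisson_law_ge0.
apply: eq_eseriesr => k _; rewrite addn1 -EFinM; congr EFin.
rewrite /poisson_law exprS factS natrM; field.
by rewrite nat1r !pnatr_eq0 -lt0n fact_gt0.
Qed.

End geometry.

Lemma ge0_integral_mrestr d (T : measurableType d) (R : realType)
    (mu : {measure set T -> \bar R}) (D : set T) (mD : measurable D)
    (f : T -> \bar R) :
  measurable_fun setT f -> (forall x, 0 <= f x)%E ->
  (\int[mrestr mu mD]_x f x = \int[mu]_(x in D) f x)%E.
Proof.
move=> mf f0; rewrite (@ge0_integral_density _ _ _ mu _ (fun x => (\1_D x)%:E))//.
- rewrite [RHS]integral_mkcond; apply: eq_integral => x _.
  by rewrite patchE indicE; case: ifPn => _; rewrite ?mule1 ?mule0.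
- by apply/measurable_EFinP; exact: measurable_indic.
- by move=> A mA; rewrite integral_indic// [D `&` A]setIC.
Qed.

(** * The point closest to a given location *)

Section poisson_process.
Context {R : realType} {d : measure_display} {T : measurableType d}.
Variables (P : probability T R) (lam : R) (X : T -> nat -> R * R).
Hypothesis lam0 : 0 < lam.
Hypothesis PPP : homogeneous_PPP P lam X.
Local Notation leb := (@lebesgue_measure R).
Local Notation count B := (fun w => count_in (X w) B).

Let mX i : measurable_fun setT (fun w => X w i).
Proof. by case: PPP. Qed.

Lemma count_inE (B : set (R * R)) w :
  (count_in (X w) B = \sum_(i <oo) (\1_B (X w i))%:E)%E.
Proof. by rewrite /count_in counting_dirac. Qed.

Lemma count_in_val (B : set (R * R)) w :
  (exists k : nat, count_in (X w) B = k%:R%:E) \/ count_in (X w) B = +oo%E.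
Proof. by rewrite /count_in /counting; case: ifPn; [left; eexists|right]. Qed.

Lemma count_in_eq0 (B : set (R * R)) w :
  count_in (X w) B = 0%E <-> forall i, ~ B (X w i).
Proof.
rewrite count_inE; split => [N0 i Bi|NB].
  have : ((\1_B (X w i) : R)%:E <= \sum_(i <oo) (\1_B (X w i) : R)%:E)%E.
    rewrite [leRHS](@nneseriesD1 _ _ i)//.
    by rewrite leeDl// nneseries_ge0// => k _ _; rewrite lee_fin.
  by rewrite N0 indicE mem_set// lee_fin ler10.
by apply: eseries0 => i _ _; rewrite indicE memNset.
Qed.

Lemma measurable_count_in (B : set (R * R)) : measurable B ->
  measurable_fun setT (count B).
Proof.
move=> mB; rewrite (_ : (fun w => _) =
    (fun w => \sum_(i <oo) (\1_B (X w i))%:E)%E); last first.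
  by apply/funext => w; exact: count_inE.
apply: ge0_emeasurable_sum => i; first by move=> w _ _; rewrite lee_fin.
have mi : measurable_fun setT (\1_B : R * R -> R) by exact: measurable_indic.
by move=> _; apply/measurable_EFinP; exact: (measurableT_comp mi (mX i)).
Qed.

Lemma measurable_count_in_eq (B : set (R * R)) (y : \bar R) : measurable B ->
  measurable [set w | count_in (X w) B = y].
Proof.
by move=> mB; exact: (measurable_preimage (measurable_count_in mB)) (emeasurable_set1 y).
Qed.

Lemma poisson_law0 (m : R) : poisson_law m 0 = expR (- m).
Proof. by rewrite /poisson_law expr0 fact0 divr1 mul1r. Qed.

Lemma PPP1 (B : set (R * R)) (k : nat) : measurable B -> bounded2 B ->
  P [set w | count_in (X w) B = k%:R%:E] =
  (poisson_law (lam * fine (area B)) k)%:E.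
Proof.
move=> mB bB; have [_ [_ H]] := PPP.
have := H 1%N (fun=> B) (fun=> k); rewrite big_ord1 => <-//.
- congr (P _); apply/seteqP; split => w /=; first by move=> ? ? _.
  by move=> /(_ ord0 Logic.I).
- by move=> i j; rewrite !ord1.
Qed.

Lemma PPP2 (B D : set (R * R)) (k l : nat) : measurable B -> bounded2 B ->
  measurable D -> bounded2 D -> B `&` D = set0 ->
  P ([set w | count_in (X w) B = k%:R%:E] `&`
     [set w | count_in (X w) D = l%:R%:E]) =
  (poisson_law (lam * fine (area B)) k * poisson_law (lam * fine (area D)) l)%:E.
Proof.
move=> mB bB mD bD BD; have [_ [_ H]] := PPP.
have := H 2%N (fun i => if i == ord0 then B else D) (fun i => if i == ord0 then k else l).
rewrite big_ord_recl big_ord1 /= => <-//.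
- congr (P _); apply/seteqP; split => w /=.
    by move=> [h1 h2] i _; case: ifP.
  move=> h; split; first exact: (h ord0).
  exact: (h (lift ord0 ord0)).
- by move=> i; case: ifP.
- by move=> [[|[|//]] ?] [[|[|//]] ?] //= _; rewrite setIC.
Qed.

Let mean_ge0 (B : set (R * R)) : 0 <= lam * fine (area B).
Proof. apply: mulr_ge0; first exact: ltW.
apply: fine_ge0; exact: (measure_ge0 (@plane R) B).
 Qed.

(** The hypothesis fixes the probabilities of the finite values; they sum to 1 and leave nothing for
    [+oo]. *)
Lemma count_in_finite (B : set (R * R)) : measurable B -> bounded2 B ->
  P [set w | count_in (X w) B = +oo%E] = 0%E.
Proof.
move=> mB bB; pose F k := [set w | count_in (X w) B = k%:R%:E].
have mF k : measurable (F k) by exact: measurable_count_in_eq.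
have tF : trivIset setT F.
  apply/trivIsetP => i j _ _ ij; rewrite -subset0 => w [/= hi hj].
  have [/eqP] := etrans (esym hi) hj.
  by rewrite eqr_nat (negbTE ij).
have PU : P (\bigcup_k F k) = 1%E.
  rewrite measure_bigcup// -[RHS](poisson_law_sum (mean_ge0 B)).
  transitivity (\sum_(k <oo) P (F k))%E.
    by apply: eq_eseriesl => k; rewrite in_setT.
  by apply: eq_eseriesr => k _; exact: PPP1.
have -> : [set w | count_in (X w) B = +oo%E] = ~` \bigcup_k F k.
  apply/seteqP; split => w /=; first by move=> h [k _]; rewrite /F/= h.
  move=> h; case: (count_in_val B w) => // -[k hk]; exfalso; apply: h.
  by exists k.
rewrite probability_setC ?PU ?subee//; exact: bigcup_measurable.
Qed.

(** Splitting by the value of the count in [B], independence over disjoint sets factors out the void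
    probability of [D], and the Poisson mean of [B] remains. *)
Lemma integral_count_void (B D : set (R * R)) : measurable B -> bounded2 B ->
  measurable D -> bounded2 D -> B `&` D = set0 ->
  (\int[P]_(w in [set w | count_in (X w) D = 0%E]) count_in (X w) B =
   (lam * fine (area B) * expR (- (lam * fine (area D))))%:E)%E.
Proof.
move=> mB bB mD bD BD.
set G := [set w | _]; pose F k := [set w | count_in (X w) B = k%:R%:E] `&` G.
pose I := [set w | count_in (X w) B = +oo%E].
have mG : measurable G by exact: measurable_count_in_eq.
have mF k : measurable (F k) by apply: measurableI => //; exact: measurable_count_in_eq.
have tF : trivIset setT F.
  apply/trivIsetP => i j _ _ ij; rewrite -subset0 => w [[/= hi _] [/= hj _]].
  have [/eqP] := etrans (esym hi) hj.
  by rewrite eqr_nat (negbTE ij).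
have mc := measurable_count_in mB.
rewrite (@ge0_negligible_integral _ _ _ _ _ I)//; last 3 first.
- exact: measurable_count_in_eq.
- exact: measurable_funTS.
- exact: count_in_finite.
have -> : G `\` I = \bigcup_k F k.
  apply/seteqP; split => w /=.
    move=> [Gw Iw]; case: (count_in_val B w) => // -[k hk].
    by exists k.
  by move=> [k _ [/= h Gw]]; split => //; rewrite /I/= h.
rewrite ge0_integral_bigcup//; last exact: measurable_funTS.
transitivity (\sum_(k <oo) ((expR (- (lam * fine (area D))))%:E *
    (k%:R * poisson_law (lam * fine (area B)) k)%:E))%E.
  apply: eq_eseriesr => k _.
  rewrite (eq_integral (cst k%:R%:E)); last by move=> w /set_mem[].
  transitivity (k%:R%:E * P (F k))%E; first by rewrite integral_cst.
  rewrite (PPP2 k 0 mB bB mD bD BD : P (F k) = _) -!EFinM.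
  move: (lam * fine (area B)) (lam * fine (area D)) => b c.
  by rewrite poisson_law0 mulrA [in LHS]mulrC.
rewrite nneseriesZl//; last first.
  by move=> k _; rewrite lee_fin mulr_ge0// poisson_law_ge0.
by rewrite poisson_law_mean// -EFinM mulrC.
Qed.

(** A point of any index in [B] makes the count nonzero, and this count is Poisson of mean 0. *)
Lemma null_area_hit (B : set (R * R)) i : measurable B -> bounded2 B ->
  area B = 0%E -> P [set w | B (X w i)] = 0%E.
Proof.
move=> mB bB B0; apply: (subset_measure0 _ _ (B := ~` [set w | count_in (X w) B = 0%E])).
- exact: (measurable_preimage (mX i)).
- exact/measurableC/measurable_count_in_eq.
- by move=> w /= Bw /count_in_eq0 /(_ i).
- transitivity (1 - P [set w | count_in (X w) B = 0%E])%E.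
    by apply: probability_setC; exact: measurable_count_in_eq.
  by rewrite (PPP1 0 mB bB) B0 mulr0 poisson_law0 oppr0 expR0 subee.
Qed.

Lemma axis_null i : P [set w | (X w i).2 = 0] = 0%E.
Proof.
(* Counts are described on bounded sets only, so the axis is exhausted by segments. *)
pose B n : set (R * R) := `[- n%:R, n%:R] `*` [set 0].
have mB n : measurable (B n) by apply: measurableX.
have mA n : measurable [set w | B n (X w i)].
  exact: (measurable_preimage (mX i)).
have -> : [set w | (X w i).2 = 0] = \bigcup_n [set w | B n (X w i)].
  apply/seteqP; split => w /=; last by move=> [n _ []].
  move=> x0; exists (Num.bound `|(X w i).1|) => //; split => //=.
  by rewrite in_itv/= -ler_norml ltW// archi_boundP.
apply/negligibleP; first exact: bigcup_measurable.
apply: negligible_bigcup => n; apply/negligibleP => //.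
apply: null_area_hit => //.
  exists n%:R => -[x y] [/= xI ->]; rewrite in_itv/= -ler_norml in xI.
  by rewrite normr0.
transitivity (leb `[(- n%:R)%R, n%:R%R] * leb [set 0%R])%E.
  by apply: product_measure1E.
by rewrite lebesgue_measure_set1 mule0.
Qed.

Definition serving (i : nat) (s : R) : set T :=
  [set w | voronoi (range (X w)) (X w i) (s, 0)].

Lemma servingP i s w :
  serving i s w <-> forall j, sqdist (s, 0) (X w i) <= sqdist (s, 0) (X w j).
Proof.
split => [h j|h _ [j _ <-]]; last exact: h.
by apply: h; exists j.
Qed.

Lemma sqdistC (x y : R * R) : sqdist x y = sqdist y x.
Proof. by rewrite /sqdist; ring. Qed.

Let msq : measurable_fun setT (fun z : R * (R * R) => sqdist (z.1, 0) z.2).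
Proof.
have m21 : measurable_fun setT (fun z : R * (R * R) => z.2.1).
  by apply: measurableT_comp.
have m22 : measurable_fun setT (fun z : R * (R * R) => z.2.2).
  by apply: measurableT_comp.
rewrite /sqdist/=; apply: measurable_funD; apply: measurable_funX => //.
- exact: measurable_funB.
- exact: measurable_funB.
Qed.

Lemma measurable_disc (s t : R) : measurable [set p : R * R | sqdist p (s, 0) < t].
Proof.
have m : measurable_fun setT (fun p : R * R => sqdist (s, 0) p).
  exact: (measurableT_comp msq (@pair1_measurable _ _ _ _ s)).
rewrite (_ : [set p | _] = (fun p => sqdist (s, 0) p) @^-1` `]-oo, t[).
  exact: (measurable_preimage m).
by apply/seteqP; split => p /=; rewrite in_itv/= sqdistC.
Qed.

Lemma bounded_disc (s t : R) : bounded2 [set p | sqdist p (s, 0) < t].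
Proof.
exists (`|s| + Num.sqrt t) => -[x y] /=; rewrite /sqdist/= subr0 => h.
have t0 : 0 < t by apply: le_lt_trans h; rewrite addr_ge0 ?sqr_ge0.
have hx : `|x - s| <= Num.sqrt t.
  by rewrite -sqrtr_sqr ler_sqrt ?ltW// (le_lt_trans _ h)// lerDl sqr_ge0.
have hy : `|y| <= Num.sqrt t.
  by rewrite -sqrtr_sqr ler_sqrt ?ltW// (le_lt_trans _ h)// lerDr sqr_ge0.
split; last by rewrite (le_trans hy)// lerDr.
by rewrite -(subrK s x) (le_trans (ler_normD _ _))// addrC lerD2l.
Qed.

Lemma measurable_serving i s : measurable (serving i s).
Proof.
have mf j : measurable_fun setT (fun w => sqdist (s, 0) (X w j)).
  exact: (measurableT_comp msq (measurable_fun_pair (measurable_cst s) (mX j))).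
rewrite (_ : serving i s = \bigcap_j [set w | sqdist (s, 0) (X w i) <= sqdist (s, 0) (X w j)]).
  apply: bigcap_measurable => // j _.
  by rewrite -[X in measurable X]setTI; apply: measurable_fun_le.
by apply/seteqP; split => w => [/servingP h j _|h]; [exact: h|apply/servingP => j; exact: h].
Qed.

(** Almost surely each disc [D n] holds finitely many points. Taking one that contains the point of
    index 0, all indices beyond some [M] are farther away than that point, so the distance is
    minimised over finitely many indices. *)
Lemma serving_ae (s : R) : P (\bigcup_i serving i s) = 1%E.
Proof.
pose D (n : nat) := [set p : R * R | sqdist p (s, 0) < n%:R].
have mD n : measurable (D n) by exact: measurable_disc.
pose I := \bigcup_n [set w | count_in (X w) (D n) = +oo%E].
have mI : measurable I.
  by apply: bigcup_measurable => n _; exact: measurable_count_in_eq.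
have I0 : P I = 0%E.
  apply/negligibleP => //; apply: negligible_bigcup => n.
  apply/negligibleP; first exact: measurable_count_in_eq.
  by apply: count_in_finite => //; exact: bounded_disc.
have sub : ~` I `<=` \bigcup_i serving i s.
  move=> w Iw; pose f j := sqdist (s, 0) (X w j).
  have f0 : f 0 < (Num.bound (f 0))%:R.
    by apply: archi_boundP; rewrite addr_ge0 ?sqr_ge0.
  have /finite_seqP[q qE] : finite_set (X w @^-1` D (Num.bound (f 0))).
    apply: contrapT => inf; apply: Iw; exists (Num.bound (f 0)) => //=.
    by rewrite /count_in /counting asboolF.
  pose M := \max_(j <- q) j.
  case: (@arg_minP _ _ 'I_M.+1 ord0 xpredT (fun i : 'I_M.+1 => f i) isT) => i _ hi.
  exists (val i) => //; apply/servingP => j.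
  have [jM|Mj] := leqP j M; first by have := hi (Ordinal (jM : (j < M.+1)%N)) isT.
  apply: (le_trans (hi ord0 isT)); apply: ltW; apply: (lt_le_trans f0).
  rewrite leNgt; apply/negP => fj.
  have : (X w @^-1` D (Num.bound (f 0))) j by rewrite /D /= sqdistC.
  rewrite qE /= => jq; have : (j <= M)%N by exact: leq_bigmax_seq.
  by rewrite leqNgt Mj.
apply/eqP; rewrite eq_le probability_le1/=; last first.
  by apply: bigcup_measurable => i _; exact: measurable_serving.
have <- : P (~` I) = 1%E.
  transitivity (1 - P I)%E; first exact: probability_setC.
  by rewrite I0 sube0.
apply: le_measure; rewrite ?inE//; first exact: measurableC.
by apply: bigcup_measurable => i _; exact: measurable_serving.
Qed.

Local Notation plT := (measurableTypeR R * measurableTypeR R)%type.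

Let mXpl i : measurable_fun setT (fun w => X w i : plT).
Proof. exact: mX. Qed.

(* The law of the point whose cell contains [(s, 0)]; summing over the indices
   avoids having to select that point. *)
Definition serving_measure (s : R) : {measure set plT -> \bar R} :=
  mseries (fun i => image_measure (mrestr P (measurable_serving i s)) (mXpl i)) 0.

Lemma serving_measureE (s : R) (B : set (R * R)) :
  (serving_measure s B = \sum_(i <oo) P (((fun w => X w i) @^-1` B) `&` serving i s))%E.
Proof. by []. Qed.

(** Cells may share boundary points, so subadditivity gives an inequality, the direction wanted
    here. *)
Lemma serving_measure_ge1 (s : R) : (1 <= serving_measure s setT)%E.
Proof.
rewrite -(serving_ae s) serving_measureE.
apply: (@le_trans _ _ (\sum_(i <oo) P (serving i s))%E).
  apply: measure_sigma_subadditive => // [i|].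
    exact: measurable_serving.
  by apply: bigcup_measurable => i _; exact: measurable_serving.
by apply: lee_nneseries => // i _; rewrite preimage_setT setTI.
Qed.

Let mgk s : measurable_fun setT (fun p : plT => (gauss_kernel lam s p)%:E).
Proof. by apply/measurable_EFinP; exact: measurable_gauss_kernel. Qed.

Let gk0 s (p : plT) : (0 <= (gauss_kernel lam s p)%:E)%E.
Proof. by rewrite lee_fin mulr_ge0// ?expR_ge0// ltW. Qed.

Definition gauss_measure (s : R) : {measure set plT -> \bar R} :=
  density_measure (@plane R) (mgk s) (gk0 s).

Lemma gauss_measureT (s : R) : gauss_measure s setT = 1%E.
Proof. exact: gauss_kernel_mass. Qed.

Section annuli.
Variables (s delta : R) (delta0 : 0 < delta).

(** The squared radius grows in equal steps, so on every annulus the kernel varies by at most the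
    same factor [expR (lam * pi * delta)]. *)
Let D (j : nat) := [set p : R * R | sqdist p (s, 0) < j%:R * delta].

Let annulus (j : nat) := D j.+1 `\` D j.

Let mD j : measurable (D j). Proof. exact: measurable_disc. Qed.

Let mA j : measurable (annulus j). Proof. exact: measurableD. Qed.

Let bA j : bounded2 (annulus j).
Proof.
have [r hr] := bounded_disc s (j.+1%:R * delta).
by exists r => p [/hr].
Qed.

Let cover_annulus : \bigcup_j annulus j = setT.
Proof.
apply/seteqP; split => // p _; have r0 : 0 <= sqdist p (s, 0) / delta.
  by rewrite divr_ge0 ?(ltW delta0)// addr_ge0// sqr_ge0.
have /andP[h1 h2] := truncn_itv r0.
exists (Num.truncn (sqdist p (s, 0) / delta)) => //; split; rewrite /D /=.
  by rewrite -ltr_pdivrMr.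
by rewrite -ltr_pdivrMr// ltNge h1.
Qed.

Let D_mono j k : (j <= k)%N -> D j `<=` D k.
Proof.
move=> jk p /lt_le_trans; apply.
by rewrite ler_pM2r// ler_nat.
Qed.

Let triv_annulus : trivIset setT annulus.
Proof.
apply/trivIsetP => i j _ _ ij; rewrite -subset0 => p [[i1 i2] [j1 j2]].
by have [h|h|h] := ltngtP i j; [exact: j2 (D_mono h _)|exact: i2 (D_mono h _)|
  rewrite h eqxx in ij].
Qed.

Lemma serving_measure_annulus j (B : set (R * R)) : measurable B ->
  (serving_measure s (B `&` annulus j) <=
   (lam * fine (area (B `&` annulus j)) * expR (- (lam * (pi * (j%:R * delta)))))%:E)%E.
Proof.
move=> mB; pose C := B `&` annulus j.
have mC : measurable C by exact: measurableI.
pose G := [set w | count_in (X w) (D j) = 0%E].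
have mG : measurable G by exact: measurable_count_in_eq.
have aD : fine (area (D j)) = pi * (j%:R * delta).
  by rewrite area_disc// mulr_ge0// ltW.
rewrite -aD -integral_count_void//; last 3 first.
- by have [r hr] := bA j; exists r => p [_ /hr].
- exact: bounded_disc.
- by rewrite -subset0 => p [[_ [_ h]] /h].
rewrite serving_measureE -/C -/G.
rewrite (_ : (\int[P]_(w in G) _)%E =
    (\sum_(i <oo) P (((fun w => X w i) @^-1` C) `&` G))%E); last first.
  under eq_integral do rewrite count_inE.
  have mi : measurable_fun setT (\1_C : R * R -> R) by exact: measurable_indic.
  rewrite integral_nneseries//; last first.
    move=> i; apply/measurable_EFinP/measurable_funTS.
    exact: (measurableT_comp mi (mX i)).
  apply: eq_eseriesr => i _.
  have mp := measurable_preimage (mX i) mC.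
  rewrite -(integral_indic P mG mp).
  by apply: eq_integral.
apply: lee_nneseries => // i _; apply: le_measure; rewrite ?inE.
- apply: measurableI; last exact: measurable_serving.
  exact: (measurable_preimage (mX i) mC).
- by apply: measurableI => //; exact: (measurable_preimage (mX i) mC).
(* A point in the inner disc would be strictly closer to [(s, 0)] than the serving point, which lies
   outside that disc. *)
move=> w [[Bw Aw] /servingP sw]; split; first by split.
apply/count_in_eq0 => k Dk; have [_ nD] := Aw; apply: nD.
by rewrite /D/=; apply: le_lt_trans Dk; rewrite sqdistC [leRHS]sqdistC.
Qed.

(** The kernel is smallest at the outer edge, hence [j.+1]. Compared with the [j] of
    [serving_measure_annulus], the loss is a factor independent of [j], so the bounds can be
    summed. *)
Lemma gauss_measure_annulus j (B : set (R * R)) : measurable B ->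
  ((lam * fine (area (B `&` annulus j)) * expR (- (lam * (pi * (j.+1%:R * delta)))))%:E
   <= gauss_measure s (B `&` annulus j))%E.
Proof.
move=> mB; pose C := B `&` annulus j.
have mC : measurable C by exact: measurableI.
have fC : area C \is a fin_num.
  rewrite ge0_fin_numE; last exact: (measure_ge0 (@plane R) C).
  apply: (@le_lt_trans _ _ (area (D j.+1))).
    by apply: (@le_measure _ _ _ (@plane R)); rewrite ?inE//; [exact: mD|move=> p [_ []]].
  by rewrite area_disc ?ltry// mulr_ge0// ltW.
rewrite /gauss_measure density_measureE mulrAC EFinM fineK//.
have -> : ((lam * expR (- (lam * (pi * (j.+1%:R * delta)))))%:E * area C =
    \int[@plane R]_(p in C) (cst (lam * expR (- (lam * (pi * (j.+1%:R * delta)))))%:E p))%E.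
  by rewrite integral_cst.
apply: ge0_le_integral => //.
- by move=> p _; rewrite lee_fin mulr_ge0 ?expR_ge0// ltW.
- exact: measurable_funTS.
move=> p [_ [Dp _]]; rewrite lee_fin /gauss_kernel ler_pM2l// ler_expR lerN2.
by rewrite mulrA ler_pM2l ?mulr_gt0 ?pi_gt0// ltW.
Qed.

Lemma serving_measure_le (B : set (R * R)) : measurable B ->
  (serving_measure s B <= (expR (lam * pi * delta))%:E * gauss_measure s B)%E.
Proof.
move=> mB; have BE : B = \bigcup_j (B `&` annulus j).
  by rewrite -setI_bigcupr cover_annulus setIT.
have mBA j : measurable (B `&` annulus j) by exact: measurableI.
have tBA : trivIset setT (fun j => B `&` annulus j) by exact: trivIset_setIl.
have SE (m : {measure set plT -> \bar R}) :
    (m B = \sum_(j <oo) m (B `&` annulus j))%E.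
  rewrite [in LHS]BE measure_bigcup//; last by move=> j _; exact: mBA.
  by apply: eq_eseriesl => j; rewrite in_setT.
rewrite (SE (serving_measure s)) (SE (gauss_measure s)) -nneseriesZl//.
apply: lee_nneseries => // j _; apply: (le_trans (serving_measure_annulus j mB)).
have e0 : (0 <= (expR (lam * pi * delta))%:E)%E by rewrite lee_fin expR_ge0.
apply: le_trans (lee_wpmul2l e0 (gauss_measure_annulus j mB)).
rewrite -EFinM lee_fin [leRHS]mulrCA -expRD; apply: ler_wpM2l.
  apply: mulr_ge0; first exact: ltW.
  by apply: fine_ge0; exact: (measure_ge0 (@plane R)).
by rewrite ler_expR -natr1; lra.
Qed.

End annuli.

(* Letting [delta] tend to 0 gives one inequality between the measures. The
   converse is free: [serving_measure s] has mass at least 1 because some point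
   is closest to [(s, 0)], and the Gaussian measure has mass exactly 1. *)
Lemma serving_measure_gauss (s : R) (B : set (R * R)) : measurable B ->
  serving_measure s B = gauss_measure s B.
Proof.
have gfin C : measurable C -> gauss_measure s C \is a fin_num.
  move=> mC; rewrite ge0_fin_numE//; apply: (@le_lt_trans _ _ 1%E); last exact: ltry.
  by rewrite -(gauss_measureT s); apply: le_measure; rewrite ?inE.
have le C : measurable C -> (serving_measure s C <= gauss_measure s C)%E.
  move=> mC; apply/lee_mul01Pr => // r /andP[r0 r1].
  have lp0 : 0 < lam * pi by rewrite mulr_gt0 ?pi_gt0.
  (* For this [delta] the factor [expR (lam * pi * delta)] equals [r^-1], with [r] arbitrary in []0,
     1[]. *)
  have d0 : 0 < - ln r / (lam * pi) by rewrite divr_gt0// oppr_gt0 ln_lt0// r0.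
  have := serving_measure_le s d0 mC.
  rewrite mulrC divfK ?gt_eqF// expRN lnK// => h.
  apply: (le_trans (lee_wpmul2l _ h)); first by rewrite lee_fin ltW.
  by rewrite muleA -EFinM divff ?mul1e// gt_eqF.
move=> mB; apply/eqP; rewrite eq_le le//=.
have SU (m : {measure set plT -> \bar R}) : (m setT = m B + m (~` B))%E.
  rewrite -(setUv B) measureU//; [exact: measurableC|exact: setICr].
have := serving_measure_ge1 s; rewrite -(gauss_measureT s).
rewrite (SU (gauss_measure s)) (SU (serving_measure s)) => h.
rewrite -(leeD2rE _ _ (gfin _ (measurableC mB))); apply: (le_trans h).
by apply: leeD2l; apply: le; exact: measurableC.
Qed.

Lemma sum_serving_integral (s : R) (f : R * R -> \bar R) :
  measurable_fun setT f -> (forall p, 0 <= f p)%E ->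
  (\sum_(i <oo) \int[P]_(w in serving i s) f (X w i) =
   \int[leb \x leb]_p (f p * (gauss_kernel lam s p)%:E))%E.
Proof.
move=> mf f0.
rewrite -(@ge0_integral_density _ _ _ (@plane R) (serving_measure s))//; last first.
  by move=> A mA; rewrite serving_measure_gauss.
rewrite [RHS]ge0_integral_measure_series//; apply: eq_eseriesr => i _.
by rewrite ge0_integral_image// ge0_integral_mrestr//; exact: (measurableT_comp mf (mX i)).
Qed.

End poisson_process.

(** * Independence of the angles *)

Section angle_law.
Context {R : realType}.
Local Notation leb := (@lebesgue_measure R).

Let mI : measurable (`[0, pi[ : set (measurableTypeR R)).
Proof. exact: measurable_itv. Qed.

Let pi_inv_ge0 : 0 <= (pi : R)^-1.
Proof. by rewrite invr_ge0 pi_ge0. Qed.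

(** The real-valued set function [unif_angle] recast as a measure, so that it can enter products and
    integrals. *)
Definition angle_law : set (measurableTypeR R) -> \bar R :=
  mscale (NngNum pi_inv_ge0) (mrestr leb mI).

HB.instance Definition _ := Measure.on angle_law.

Let leb_period : leb `[0, pi[ = pi%:E.
Proof. by rewrite lebesgue_measure_itv/= lte_fin pi_gt0 sube0. Qed.

Let angle_lawT : angle_law setT = 1%E.
Proof.
rewrite /angle_law /mscale/= /mrestr setTI leb_period -EFinM.
by rewrite mulVf// gt_eqF// pi_gt0.
Qed.

HB.instance Definition _ :=
  Measure_isProbability.Build _ _ R angle_law angle_lawT.

Lemma angle_lawE (A : set R) : angle_law A = (pi^-1%:E * leb (A `&` `[0%R, pi[))%E.
Proof. by []. Qed.

Lemma unif_angleE (A : set R) : measurable A -> (unif_angle A)%:E = angle_law A.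
Proof.
move=> mA; rewrite angle_lawE /unif_angle EFinM fineK 1?muleC//.
rewrite ge0_fin_numE//; apply: (@le_lt_trans _ _ (leb `[0, pi[)).
  by apply: le_measure; rewrite ?inE//; exact: measurableI.
by rewrite leb_period ltry.
Qed.

Lemma crossing_periodic (x : R * R) (phi : R) :
  crossing x (phi + pi) = crossing x phi.
Proof. by rewrite /crossing cosDpi sinDpi invrN mulrNN. Qed.

(** A line is unchanged when its angle grows by [pi], so the event is periodic and the offset [a]
    drops out. The condition on the sine discards the junk value of [crossing]. *)
Lemma crossing_angle_law (x : R * R) (a : R) (S : set R) :
  x.2 != 0 -> 0 <= a <= pi -> measurable S ->
  angle_law [set phi | sin (phi + a) != 0 /\ S (crossing x (phi + a))] =
  (pi^-1%:E * \int[leb]_(s in S) (crossing_density x s)%:E)%E.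
Proof.
move=> x0 api mS; rewrite angle_lawE; congr (_ * _)%E.
pose A := [set phi | sin phi != 0 /\ S (crossing x phi)].
have mcr : measurable_fun setT (crossing x).
  exact: (@measurable_crossing _ _ _ (cst x) id).
have mA : measurable A.
  rewrite (_ : A = (@sin R) @^-1` [set~ 0] `&` crossing x @^-1` S); last first.
    by apply/seteqP; split => phi /= [/eqP].
  apply: measurableI; last exact: (measurable_preimage mcr).
  apply: measurable_preimage; last exact: measurableC.
  by apply: continuous_measurable_fun; exact: continuous_sin.
rewrite -crossing_law//.
rewrite (_ : [set phi | _] = (fun phi => phi + a) @^-1` A)//.
rewrite lebesgue_measure_periodic//; last first.
  by move=> phi; rewrite /A /= crossing_periodic sinDpi oppr_eq0.
congr (leb _); apply/seteqP; split => phi /=; rewrite !in_itv/=.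
  move=> [[s0 Sphi] /andP[p0 ppi]]; split => //; rewrite ppi andbT lt_neqAle p0 andbT.
  by apply: contra s0 => /eqP <-; rewrite sin0.
move=> [Sphi p]; have /andP[p0 ppi] := p; rewrite (ltW p0) ppi; split => //.
by split => //; rewrite gt_eqF// sin_gt0_pi.
Qed.

End angle_law.

Section independence.
Context {R : realType} {d : measure_display} {T : measurableType d}.
Variables (P : probability T R) (X : T -> nat -> R * R) (th : T -> nat -> R).
Hypothesis mX : forall i, measurable_fun setT (fun w => X w i).
Hypothesis marks : iid_uniform_marks P X th.

Let mth i : measurable_fun setT (fun w => th w i).
Proof. by case: marks. Qed.

Definition cylinder (m : nat) (C : nat -> set (R * R)) (A : nat -> set R) : set T :=
  \bigcap_(j in `I_m) ([set w | C j (X w j)] `&` [set w | A j (th w j)]).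

Lemma measurable_cylinder m C A : (forall j, measurable (C j)) ->
  (forall j, measurable (A j)) -> measurable (cylinder m C A).
Proof.
move=> mC mA; apply: bigcap_measurableType => j _; apply: measurableI;
  first exact: (measurable_preimage (mX j)).
exact: (measurable_preimage (mth j)).
Qed.

(** Vacuous constraints beyond [m] bring two cylinders to a common length. *)
Let pad {U : Type} (m : nat) (A : nat -> set U) (j : nat) : set U :=
  if (j < m)%N then A j else setT.

Let measurable_pad d' (U : measurableType d') m (A : nat -> set U) j :
  (forall j, measurable (A j)) -> measurable (pad m A j).
Proof. by move=> mA; rewrite /pad; case: ifP. Qed.

Let cylinder_pad m M C A : (m <= M)%N ->
  cylinder m C A = cylinder M (pad m C) (pad m A).
Proof.
move=> mM; apply/seteqP; split => w h j /= jM.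
  by split; rewrite /pad; case: ltnP => // jm; have [] := h j jm.
have [h1 h2] := h j (leq_trans jM mM).
by split; [move: h1|move: h2]; rewrite /= /pad jM.
Qed.

(* These events generate the sigma-algebra of all the points and of all the
   angles but the [i]-th one. *)
Definition cylinders_but (i : nat) : set (set T) :=
  [set G | exists m C A, [/\ forall j, measurable (C j), forall j, measurable (A j),
    A i = setT & G = cylinder m C A]].

Let cylinders_setT i : cylinders_but i setT.
Proof.
exists 0%N, (fun=> setT), (fun=> setT); split => //.
by apply/seteqP; split.
Qed.

Let cylinders_setI i : setI_closed (cylinders_but i).
Proof.
move=> _ _ [m [C [A [mC mA Ai ->]]]] [m' [C' [A' [mC' mA' Ai' ->]]]].
rewrite (@cylinder_pad m (maxn m m')) ?leq_maxl//.
rewrite (@cylinder_pad m' (maxn m m')) ?leq_maxr//.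
exists (maxn m m'), (fun j => pad m C j `&` pad m' C' j),
  (fun j => pad m A j `&` pad m' A' j); split.
- by move=> j; apply: measurableI; exact: measurable_pad.
- by move=> j; apply: measurableI; exact: measurable_pad.
- by rewrite /pad Ai Ai' !if_same setTI.
- apply/seteqP; split => w.
    by move=> [h h'] j jM; have [? ?] := h j jM; have [? ?] := h' j jM.
  by move=> h; split => j jM; have [[? ?] [? ?]] := h j jM.
Qed.

Local Notation sigma_but i := (g_sigma_algebraType (cylinders_but i)).

Let measurable_idT i : measurable_fun setT (id : T -> sigma_but i).
Proof.
move=> _ B mB; rewrite setTI.
apply: (smallest_sub (@sigma_algebra_measurable _ T) _ mB).
by move=> _ [m [C [A [mC mA _ ->]]]]; exact: measurable_cylinder.
Qed.

Let indep_cylinder i G B : cylinders_but i G -> measurable B ->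
  P (G `&` [set w | B (th w i)]) = (P G * angle_law B)%E.
Proof.
(* The length must exceed [i] for the cylinder to have a slot for the angle of index [i];
   [A i = setT] leaves that slot free for [B]. *)
move=> [m [C [A [mC mA Ai ->]]]] mB; pose M := maxn m i.+1.
have iM : (i < M)%N by rewrite leq_max ltnSn orbT.
rewrite (@cylinder_pad m M) ?leq_maxl//.
pose C0 := pad m C; pose A0 := pad m A.
pose A1 j := if j == i then B else A0 j.
have mC0 j : measurable (C0 j) by exact: measurable_pad.
have mA0 j : measurable (A0 j) by exact: measurable_pad.
have mA1 j : measurable (A1 j) by rewrite /A1; case: ifP.
have A0i : A0 i = setT by rewrite /A0 /pad Ai if_same.
rewrite -/C0 -/A0 (_ : _ `&` _ = cylinder M C0 A1); last first.
  apply/seteqP; split => w /=.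
    move=> [h Bw] j jM; have [? ?] := h j jM; split => //=.
    by rewrite /A1; case: eqP => [->|].
  move=> h; split; last by have [_ /=] := h i iM; rewrite /A1 eqxx.
  move=> j jM; have [h1 h2] := h j jM; split => //=.
  by move: h2; rewrite /= /A1; case: eqP => [->|//]; rewrite A0i.
have [_ mk] := marks.
rewrite [LHS](mk M C0 A1)// [X in (_ = X * _)%E](mk M C0 A0)//.
rewrite (bigD1 (Ordinal iM))//= [in RHS](bigD1 (Ordinal iM))//= A0i.
rewrite {1}/A1 eqxx -muleA -unif_angleE// -EFinM; congr (_ * _%:E)%E.
have -> : unif_angle [set: R] = 1.
  by apply: EFin_inj; rewrite unif_angleE// probability_setT.
rewrite mul1r mulrC; congr (_ * _); apply: eq_bigr => j ji.
by rewrite /A1 (_ : _ == i = false)//; apply: contraNF ji => /eqP ji; exact/eqP/val_inj.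
Qed.

(** For fixed [B] both sides are finite measures in [G], equal on a generating family that is closed
    under intersection. *)
Let indep_sigma i G B : <<s cylinders_but i >> G -> measurable B ->
  P (G `&` [set w | B (th w i)]) = (P G * angle_law B)%E.
Proof.
move=> mG mB.
pose B' := [set w : T | B (th w i)].
have mB' : measurable B' by exact: (measurable_preimage (mth i)).
have B0 : 0 <= fine (angle_law B) by rewrite fine_ge0.
have fB : (fine (angle_law B))%:E = angle_law B by rewrite fineK// fin_num_measure.
rewrite -fB muleC -[LHS]/(mrestr P mB' G) -[RHS]/(mscale (NngNum B0) P G).
apply: (@g_sigma_algebra_measure_unique _ R T (cylinders_but i) _ (fun=> setT)) => //.
- by move=> _ [m [C [A [mC mA _ ->]]]]; exact: measurable_cylinder.
- by rewrite bigcup_const.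
- by move=> H GH; rewrite /= /mscale /mrestr /= fB muleC; exact: indep_cylinder.
- move=> _; apply: (@le_lt_trans _ _ (P setT)).
    by apply: le_measure; rewrite ?inE//; exact: measurableI.
  by rewrite probability_setT ltry.
Qed.

Lemma measurable_with_mark i : measurable_fun setT
  (fun w : T => ((w, th w i) : sigma_but i * measurableTypeR R)).
Proof. by apply: measurable_fun_pair; [exact: measurable_idT|exact: mth]. Qed.

(** Measurability of [f] for [sigma_but i] in its first argument expresses that the [i]-th angle
    enters only through the second. The joint law of the pair is then a product, and Tonelli
    applies. *)
Lemma integral_angle i (f : sigma_but i * measurableTypeR R -> \bar R) :
  measurable_fun setT f -> (forall z, 0 <= f z)%E ->
  (\int[P]_w f (w, th w i) = \int[P]_w \int[angle_law]_phi f (w, phi))%E.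
Proof.
move=> mf f0.
have mpair := @measurable_with_mark i.
pose Pi := image_measure P (@measurable_idT i).
have PiT : Pi setT = 1%E by exact: probability_setT.
pose Pp : probability (sigma_but i) R :=
  HB.pack (Pi : set _ -> _) Pi (Measure_isProbability.Build _ _ R Pi PiT).
rewrite -(ge0_integral_image P mpair)//.
transitivity (\int[(Pp \x angle_law)%E]_z f z)%E.
  apply: eq_measure_integral => A mA _.
  apply/esym/product_measure_unique => // G B mG mB.
  exact: (indep_sigma mG mB).
rewrite fubini_tonelli1//; apply: (ge0_integral_image P (@measurable_idT i)).
- exact: measurable_fun_fubini_tonelli_F.
- by move=> w; apply: integral_ge0.
Qed.

Lemma measurable_point_but i j :
  measurable_fun setT ((fun w => X w j) : sigma_but i -> R * R).
Proof.
move=> _ B mB; rewrite setTI; apply: sub_sigma_algebra.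
exists j.+1, (fun k => if k == j then B else setT), (fun=> setT); split => //.
  by move=> k; case: ifP.
apply/seteqP; split => w /=.
  by move=> Bw k _; split => //=; case: eqP => [->|].
by move=> h; have [/=] := h j (ltnSn j); rewrite eqxx.
Qed.

Lemma measurable_mark_but i j : j != i ->
  measurable_fun setT ((fun w => th w j) : sigma_but i -> R).
Proof.
move=> ji _ B mB; rewrite setTI; apply: sub_sigma_algebra.
exists j.+1, (fun=> setT), (fun k => if k == j then B else setT); split => //.
- by move=> k; case: ifP.
- by rewrite eq_sym (negbTE ji).
apply/seteqP; split => w /=.
  by move=> Bw k _; split => //=; case: eqP => [->|].
by move=> h; have [_ /=] := h j (ltnSn j); rewrite eqxx.
Qed.

End independence.

(** * Counting the reselection points *)

Section beam_count.
Context {R : realType} {d : measure_display} {T : measurableType d}.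
Variables (P : probability T R) (lam : R) (X : T -> nat -> R * R) (th : T -> nat -> R).
Variables (n : nat) (l : R).
Hypotheses (lam0 : 0 < lam) (n1 : (1 <= n)%N) (l0 : 0 < l).
Hypothesis PPP : homogeneous_PPP P lam X.
Hypothesis marks : iid_uniform_marks P X th.
Local Notation leb := (@lebesgue_measure R).
Local Notation K := (2 ^ (n - 1))%N.
Local Notation mR := (measurableTypeR R).
Local Notation sigma_but i := (g_sigma_algebraType (cylinders_but X th i)).

Let mX i : measurable_fun setT (fun w => X w i).
Proof. by case: PPP. Qed.

Let mth i : measurable_fun setT (fun w => th w i).
Proof. by case: marks. Qed.

Let offset (k : nat) : R := k%:R * pi / 2 ^+ (n - 1).

Let offset_itv k : (k < K)%N -> 0 <= offset k < pi.
Proof.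
move=> kK; rewrite /offset; apply/andP; split.
  by rewrite divr_ge0 ?mulr_ge0 ?pi_ge0// exprn_ge0.
rewrite ltr_pdivrMr ?exprn_gt0// mulrC ltr_pM2l ?pi_gt0//.
by rewrite -natrX ltr_nat.
Qed.

Let offset_lt j k : (j < k)%N -> offset j < offset k.
Proof.
move=> jk; rewrite /offset ltr_pM2r ?invr_gt0 ?exprn_gt0//.
by rewrite ltr_pM2r ?pi_gt0// ltr_nat.
Qed.

Let density0 (x : R * R) s : 0 <= crossing_density x s.
Proof. by rewrite divr_ge0// addr_ge0// sqr_ge0. Qed.

Let msin : measurable_fun setT (@sin R).
Proof. by apply: continuous_measurable_fun; exact: continuous_sin. Qed.

(** [S] may depend on the abscissa and on everything but the [i]-th angle, which covers both
    membership in a cell and coincidence with another crossing. *)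
Lemma crossing_event_prob i (a : R) (S : set (sigma_but i * mR)) :
  0 <= a <= pi -> measurable S ->
  P [set w | (X w i).2 != 0 /\ (sin (th w i + a) != 0 /\
             S (w, crossing (X w i) (th w i + a)))] =
  (\int[P]_w (pi^-1%:E * \int[leb]_s
     ((crossing_density (X w i) s)%:E * (\1_S (w, s))%:E)))%E.
Proof.
move=> api mS; have mXi := @measurable_point_but _ _ _ X th i i.
have mX1 : measurable_fun setT (fun z : sigma_but i * mR => X z.1 i).
  exact: (measurableT_comp mXi measurable_fst).
have ma : measurable_fun setT (fun z : sigma_but i * mR => z.2 + a : R).
  by apply: measurable_funD => //; exact: measurable_snd.
have mcr : measurable_fun setT
    (fun z : sigma_but i * mR => crossing (X z.1 i) (z.2 + a)).
  exact: measurable_crossing.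
pose Q : set (sigma_but i * mR) := [set z | (X z.1 i).2 != 0 /\
  (sin (z.2 + a) != 0 /\ S (z.1, crossing (X z.1 i) (z.2 + a)))].
have mQ : measurable Q.
  rewrite (_ : Q = (fun z => (X z.1 i).2) @^-1` [set~ 0] `&`
    ((fun z => sin (z.2 + a)) @^-1` [set~ 0] `&`
     (fun z => (z.1, crossing (X z.1 i) (z.2 + a))) @^-1` S)); last first.
    apply/seteqP; split => z /= [].
      by move=> /eqP ? [/eqP ? ?].
    by move=> /eqP ? [/eqP ? ?].
  apply: measurableI; last apply: measurableI.
  - apply: measurable_preimage; last exact: measurableC.
    exact: (measurableT_comp measurable_snd mX1).
  - apply: measurable_preimage; last exact: measurableC.
    exact: (measurableT_comp msin ma).
  - by apply: (measurable_preimage _ mS); apply: measurable_fun_pair;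
      [exact: measurable_fst|exact: mcr].
have mQi : measurable_fun setT (fun z => (\1_Q z : R)%:E).
  by apply/measurable_EFinP; exact: measurable_indic.
set W := [set w | _].
have mW : measurable W.
  exact: (measurable_preimage (measurable_with_mark mX marks (i := i)) mQ).
transitivity (\int[P]_w (\1_W w)%:E)%E; first by rewrite integral_indic// setIT.
transitivity (\int[P]_w (\1_Q ((w : sigma_but i), th w i))%:E)%E.
  by apply: eq_integral.
rewrite (integral_angle mX marks mQi)//.
apply: eq_integral => w _.
have mSw : measurable (xsection S w) by exact: measurable_xsection.
rewrite (_ : (\int[leb]_s _)%E =
    (\int[leb]_(s in xsection S w) (crossing_density (X w i) s)%:E)%E); last first.
  rewrite [RHS]integral_mkcond; apply: eq_integral => s _.
  by rewrite patchE indicE mem_xsection; case: ifPn => _; rewrite ?mule1 ?mule0.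
(* A point on the axis contributes 0 to both sides: the event excludes it, and [crossing_density]
   vanishes. *)
have [x0|x0] := eqVneq (X w i).2 0.
  rewrite !integral0_eq ?mule0//.
  - by move=> s _; rewrite /crossing_density x0 normr0 mul0r.
  - by move=> phi _; rewrite indicE memNset// => -[/=]; rewrite x0 eqxx.
rewrite -(crossing_angle_law x0 api mSw).
have mQw : measurable (xsection Q w) by exact: measurable_xsection.
transitivity (\int[angle_law]_phi (\1_(xsection Q w) phi)%:E)%E.
  by apply: eq_integral => phi _; rewrite !indicE mem_xsection.
rewrite integral_indic// setIT; congr (angle_law _).
apply/seteqP; split => phi /=.
  by move=> /set_mem [_ [? ?]]; split => //; apply/mem_set.
by move=> [? /set_mem ?]; apply/mem_set.
Qed.

(** With the [i]-th angle left out, the crossing of [j] is a fixed number, while that of [i] has a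
    density. *)
Lemma crossing_tie_null i j (a b : R) : i != j -> 0 <= a <= pi ->
  P [set w | (X w i).2 != 0 /\ (sin (th w i + a) != 0 /\
     crossing (X w i) (th w i + a) = crossing (X w j) (th w j + b))] = 0%E.
Proof.
move=> ij api.
pose g (z : sigma_but i * mR) : R := z.2 - crossing (X z.1 j) (th z.1 j + b).
have mg : measurable_fun setT g.
  apply: measurable_funB; first exact: measurable_snd.
  apply: measurable_crossing.
    exact: (measurableT_comp (@measurable_point_but _ _ _ X th i j) measurable_fst).
  apply: measurable_funD => //.
  have mt := @measurable_mark_but _ _ _ X th i j; rewrite eq_sym in ij.
  exact: (measurableT_comp (mt ij) measurable_fst).
pose S := g @^-1` [set 0].
have mS : measurable S by exact: (measurable_preimage mg).
rewrite (_ : [set w | _] = [set w | (X w i).2 != 0 /\ (sin (th w i + a) != 0 /\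
    S (w, crossing (X w i) (th w i + a)))]); last first.
  apply/seteqP; split => w [? [? h]]; split => //; split => //.
    by rewrite /S /g /= h subrr.
  by move/eqP: h; rewrite /g /= subr_eq0 => /eqP.
rewrite crossing_event_prob//; apply: integral0_eq => w _.
pose c := crossing (X w j) (th w j + b).
have -> : (\int[leb]_s ((crossing_density (X w i) s)%:E * (\1_S (w, s))%:E) =
    \int[leb]_(s in [set c]) (crossing_density (X w i) s)%:E)%E.
  rewrite [RHS]integral_mkcond; apply: eq_integral => s _.
  rewrite patchE indicE (_ : ((w, s) \in S) = (s \in [set c])); last first.
    apply/idP/idP => /set_mem h; apply/mem_set; move: h; rewrite /S /g /=.
      by move/eqP; rewrite subr_eq0 => /eqP.
    by move=> ->; rewrite subrr.
  by case: ifPn => _; rewrite ?mule1 ?mule0.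
by rewrite integral_set1 mule0.
Qed.

Let cell_set (i : nat) : set (T * R) := [set z | 0 <= z.2 <= l /\ serving X i z.2 z.1].

(** Stated over any [U] because the cell must be measurable both for the full sigma-algebra and for
    [sigma_but i]. *)
Let measurable_cell d' (U : measurableType d') (Y : U -> nat -> R * R) i :
  (forall j, measurable_fun setT (fun u => Y u j)) ->
  measurable [set z : U * mR | 0 <= z.2 <= l /\
    forall j, sqdist (z.2, 0) (Y z.1 i) <= sqdist (z.2, 0) (Y z.1 j)].
Proof.
move=> mY.
have msq j : measurable_fun setT (fun z : U * mR => sqdist (z.2, 0) (Y z.1 j)).
  have m1 := measurableT_comp (mY j) (@measurable_fst _ _ U mR).
  have m11 := measurableT_comp measurable_fst m1.
  have m12 := measurableT_comp measurable_snd m1.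
  rewrite /sqdist/=; apply: measurable_funD; apply: measurable_funX.
    by apply: measurable_funB => //; exact: measurable_snd.
  by apply: measurable_funB.
rewrite (_ : [set z | _] = (@snd U mR) @^-1` `[0, l] `&` \bigcap_j
    [set z : U * mR | sqdist (z.2, 0) (Y z.1 i) <= sqdist (z.2, 0) (Y z.1 j)]).
  apply: measurableI; first by apply: measurable_preimage => //; exact: measurable_snd.
  apply: bigcap_measurableType => j _.
  by rewrite -[X in measurable X]setTI; apply: measurable_fun_le.
apply/seteqP; split => z /=; rewrite in_itv/= => -[? h]; split => // j.
  by move=> _; exact: h.
exact: (h j Logic.I).
Qed.

Let measurable_cell_set i : measurable (cell_set i : set (T * mR)).
Proof.
rewrite (_ : cell_set i = [set z : T * mR | 0 <= z.2 <= l /\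
    forall j, sqdist (z.2, 0) (X z.1 i) <= sqdist (z.2, 0) (X z.1 j)]).
  exact: measurable_cell.
by apply/seteqP; split => z [? /servingP h]; split => //; apply/servingP.
Qed.

Let crossing_at i k w : R := crossing (X w i) (th w i + offset k).

(** The bound on [k] is part of the event, so that counts become series over all pairs of
    naturals. *)
Let hit (i k : nat) : set T := [set w | (k < K)%N /\ ((X w i).2 != 0 /\
  (sin (th w i + offset k) != 0 /\ cell_set i (w, crossing_at i k w)))].

Let cell_mass i : \bar R := (\int[P]_w \int[leb]_s
  ((crossing_density (X w i) s)%:E * (\1_(cell_set i) (w, s))%:E))%E.

Let measurable_hit i k : measurable (hit i k).
Proof.
have mc : measurable_fun setT (crossing_at i k).
  by apply: measurable_crossing => //; exact: measurable_funD.
have [kK|kK] := boolP (k < K)%N; last first.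
  by rewrite (_ : hit i k = set0)//; apply/seteqP; split => w // -[]; rewrite (negbTE kK).
rewrite (_ : hit i k = (fun w => (X w i).2) @^-1` [set~ 0] `&`
    ((fun w => sin (th w i + offset k)) @^-1` [set~ 0] `&`
     (fun w => (w, crossing_at i k w)) @^-1` cell_set i)); last first.
  apply/seteqP; split => w /=.
    by move=> [_ [/eqP ? [/eqP ? ?]]].
  by move=> [/eqP ? [/eqP ? ?]].
apply: measurableI; last apply: measurableI.
- apply: measurable_preimage; last exact: measurableC.
  exact: (measurableT_comp measurable_snd (mX i)).
- apply: measurable_preimage; last exact: measurableC.
  by apply: (measurableT_comp msin); exact: measurable_funD.
- apply: (measurable_preimage _ (measurable_cell_set i)).
  by apply: measurable_fun_pair.
Qed.

Let measurable_cell_density i : measurable_fun setT (fun z : T * mR =>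
  ((crossing_density (X z.1 i) z.2)%:E * (\1_(cell_set i) z)%:E)%E).
Proof.
apply: emeasurable_funM; apply/measurable_EFinP; last exact: measurable_indic.
have mp : measurable_fun setT (fun z : T * mR => ((X z.1 i, z.2) : (R * R) * R)).
  apply: measurable_fun_pair; last exact: measurable_snd.
  exact: (measurableT_comp (mX i) measurable_fst).
exact: (measurableT_comp measurable_crossing_density mp).
Qed.

Let cell_density_ge0 i (z : T * mR) :
  (0 <= (crossing_density (X z.1 i) z.2)%:E * (\1_(cell_set i) z)%:E)%E.
Proof. by apply: mule_ge0; rewrite lee_fin. Qed.

Let hit_prob i k : (k < K)%N -> P (hit i k) = (pi^-1%:E * cell_mass i)%E.
Proof.
move=> kK; have mXb j := @measurable_point_but _ _ _ X th i j.
have mS := measurable_cell i mXb.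
have op : 0 <= offset k <= pi by have /andP[-> /ltW ->] := offset_itv kK.
rewrite (_ : hit i k = [set w | (X w i).2 != 0 /\ (sin (th w i + offset k) != 0 /\
  [set z : sigma_but i * mR | 0 <= z.2 <= l /\
    forall j, sqdist (z.2, 0) (X z.1 i) <= sqdist (z.2, 0) (X z.1 j)]
  ((w : sigma_but i), crossing_at i k w))]); last first.
  apply/seteqP; split => w /=.
    by move=> [_ [? [? [? /servingP ?]]]].
  by move=> [? [? [? ?]]]; split => //; split => //; split => //; split => //;
    apply/servingP.
rewrite (crossing_event_prob op mS); transitivity (\int[P]_w (pi^-1%:E * \int[leb]_s
    ((crossing_density (X w i) s)%:E * (\1_(cell_set i) (w, s))%:E)))%E; last first.
  apply: ge0_integralZl => //.
  - exact: (@measurable_fun_fubini_tonelli_F _ _ _ _ _ leb _ (measurable_cell_density i)).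
  - by move=> w _; apply: integral_ge0 => s _; exact: (cell_density_ge0 i (w, s)).
  - by rewrite lee_fin invr_ge0 pi_ge0.
apply: eq_integral => w _; congr (_ * _)%E; apply: eq_integral => s _.
congr (_ * _%:E)%E; rewrite !indicE; congr (nat_of_bool _)%:R.
apply/idP/idP => /set_mem /= [? h]; apply/mem_set; split => //=; exact/servingP.
Qed.

(** Once Tonelli moves the abscissa outside, the sum over [i] at each [s] in [[0, l]] is the same
    constant, so the length factors out. *)
Let sum_cell_mass : (\sum_(i <oo) cell_mass i = (2 * Num.sqrt lam * l)%:E)%E.
Proof.
under eq_eseriesr => i _.
  rewrite /cell_mass (@fubini_tonelli _ _ _ _ _ P leb _ (measurable_cell_density i))//; over.
rewrite -integral_nneseries//; last 2 first.
- move=> i;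
  exact: (@measurable_fun_fubini_tonelli_G _ _ _ _ _ P _ (measurable_cell_density i)).
- by move=> i s _; apply: integral_ge0 => w _; exact: (cell_density_ge0 i (w, s)).
transitivity (\int[leb]_(s in `[0%R, l]) (cst (2 * Num.sqrt lam)%:E s))%E.
  rewrite [RHS]integral_mkcond; apply: eq_integral => s _; rewrite patchE.
  case: ifPn => sI; last first.
    apply: eseries0 => i _ _; apply: integral0_eq => w _.
    rewrite indicE memNset ?mule0// => -[/= h _].
    by move/negP: sI; apply; apply/mem_set; rewrite /= in_itv.
  rewrite -(crossing_density_gauss s lam0).
  have mds : measurable_fun setT (fun p : R * R => (crossing_density p s)%:E).
    apply/measurable_EFinP.
    exact: (measurableT_comp measurable_crossing_density (@pair2_measurable _ _ _ _ s)).
  have d0 p : (0 <= (crossing_density p s)%:E)%E by rewrite lee_fin.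
  rewrite -(sum_serving_integral lam0 PPP s mds d0).
  apply: eq_eseriesr => i _; rewrite [RHS]integral_mkcond; apply: eq_integral => w _.
  rewrite patchE indicE (_ : ((w, s) \in cell_set i) = (w \in serving X i s)).
    by case: ifPn => _; rewrite ?mule1 ?mule0.
  apply/idP/idP => /set_mem; first by move=> [_ ?]; exact/mem_set.
  by move=> h; apply/mem_set; split => //=; move/set_mem: sI; rewrite /= in_itv.
rewrite integral_cst//= lebesgue_measure_itv/= lte_fin l0 -EFinB subr0.
by rewrite -EFinM.
Qed.

(** A horizontal line through a point off the axis never meets the axis, which forces the sine to be
    nonzero. *)
Lemma on_line_crossing (x : R * R) (phi s : R) : x.2 != 0 ->
  on_line x phi (s, 0) <-> sin phi != 0 /\ s = crossing x phi.
Proof.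
case: x => x y /= y0; rewrite /on_line /crossing /= sub0r; split.
  move=> h; have s0 : sin phi != 0.
    apply/eqP => s0; move/eqP: h; rewrite s0 mulr0 sub0r oppr_eq0 mulf_eq0 oppr_eq0.
    rewrite (negbTE y0)/= => /eqP c0; have := cos2Dsin2 phi.
    by rewrite s0 c0 expr0n addr0 => /eqP; rewrite eq_sym oner_eq0.
  split => //; apply: (mulIf s0); rewrite mulrBl -mulrA divfK//; lra.
by move=> [s0 ->]; field.
Qed.

Let tie (i j k k' : nat) : set T := [set w | (i != j) && (k < K)%N /\
  ((X w i).2 != 0 /\ (sin (th w i + offset k) != 0 /\
   crossing_at i k w = crossing_at j k' w))].

Let tie_negligible i j k k' : P.-negligible (tie i j k k').
Proof.
have [/andP[ij kK]|h] := boolP ((i != j) && (k < K)%N); last first.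
  have -> : tie i j k k' = set0; last exact: negligible_set0.
  by apply/seteqP; split => w // -[]; rewrite (negbTE h).
have mc i' k0 : measurable_fun setT (crossing_at i' k0).
  by apply: measurable_crossing => //; exact: measurable_funD.
have mt : measurable [set w | (X w i).2 != 0 /\ (sin (th w i + offset k) != 0 /\
   crossing_at i k w = crossing_at j k' w)].
  rewrite (_ : [set w | _] = (fun w => (X w i).2) @^-1` [set~ 0] `&`
    ((fun w => sin (th w i + offset k)) @^-1` [set~ 0] `&`
     (fun w => crossing_at i k w - crossing_at j k' w) @^-1` [set 0])); last first.
    apply/seteqP; split => w /=.
      by move=> [/eqP ? [/eqP ? ->]]; rewrite subrr.
    by move=> [/eqP ? [/eqP ? /eqP]]; rewrite subr_eq0 => /eqP.
  apply: measurableI; last apply: measurableI.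
  - apply: measurable_preimage; last exact: measurableC.
    exact: (measurableT_comp measurable_snd (mX i)).
  - apply: measurable_preimage; last exact: measurableC.
    by apply: (measurableT_comp msin); exact: measurable_funD.
  - by apply: measurable_preimage => //; exact: measurable_funB.
apply: (@negligibleS _ _ _ _ [set w | (X w i).2 != 0 /\
    (sin (th w i + offset k) != 0 /\ crossing_at i k w = crossing_at j k' w)]).
  by move=> w [].
apply/negligibleP => //; apply: crossing_tie_null => //.
by have /andP[-> /ltW ->] := offset_itv kK.
Qed.

Let bad : set T := (\bigcup_i [set w | (X w i).2 = 0]) `|`
  \bigcup_i \bigcup_j \bigcup_k \bigcup_k' tie i j k k'.

Let bad_negligible : P.-negligible bad.
Proof.
apply: negligibleU.
  apply: negligible_bigcup => i; apply/negligibleP; last exact: (axis_null PPP).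
  exact: (measurable_preimage (measurableT_comp measurable_snd (mX i)) (measurable_set1 0)).
by do 4 (apply: negligible_bigcup => ?); exact: tie_negligible.
Qed.

Let total w : \bar R := (\sum_(i <oo) \sum_(k <oo) (\1_(hit i k) w)%:E)%E.

(** The left side counts a set of abscissas, the right side counts pairs [(i, k)]. They agree
    because the crossing determines the pair: distinct points do not tie outside [bad], and distinct
    lines of one point meet only at that point, off the axis. *)
Let count_Psi_total w : ~ bad w -> count_Psi n (X w) (th w) 0 l = total w.
Proof.
move=> good.
have axis i : (X w i).2 != 0.
  by apply/eqP => h; apply: good; left; exists i.
pose I := [set z : nat * nat | hit z.1 z.2 w].
have -> : count_Psi n (X w) (th w) 0 l =
    (\esum_(s in (fun z => crossing_at z.1 z.2 w) @` I) 1)%E.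
  rewrite /count_Psi; congr esum; apply/seteqP; split => s /=.
    rewrite in_itv/= => -[[i [k [kK [/on_line_crossing -/(_ (axis i)) [s0 sE] vs]]]] sl].
    have e : crossing_at i k w = s by rewrite sE.
    by exists (i, k) => //; rewrite /I /hit /cell_set /= e; do !split.
  move=> [[i k] [/= kK [_ [s0 [sl vs]]]] <-]; rewrite in_itv/=; split => //.
  exists i, k; split => //; split => //.
  by apply/on_line_crossing.
rewrite esum_image; last first.
  move=> [i k] [j k'] /set_mem[/= kK [_ [s0 _]]] /set_mem[/= k'K [_ [s0' _]]] e.
  have [ij|ij] := eqVneq i j; last first.
    exfalso; apply: good; right; exists i => //; exists j => //; exists k => //.
    by exists k' => //; split => //; rewrite ij kK.
  move: e s0'; rewrite -ij => e s0'.
  (* Equal crossings from one point off the axis mean equal cotangents. Both offsets lie in [[0,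
     pi[], so a vanishing sine of their difference forces [k = k']. *)
  have sE : sin (offset k' - offset k) = 0.
    move/addrI/oppr_inj/(mulfI (axis i))/eqP: e; rewrite eqr_div// => /eqP e.
    rewrite (_ : offset k' - offset k = (th w i + offset k') - (th w i + offset k));
      last by ring.
    by rewrite sinB; apply/eqP; rewrite subr_eq0 mulrC e mulrC.
  have /andP[a1 a2] := offset_itv kK; have /andP[b1 b2] := offset_itv k'K.
  have [lt|lt|->//] := ltngtP k k'.
    have := offset_lt lt => olt; have := @sin_gt0_pi R (offset k' - offset k).
    by rewrite sE ltxx; move=> F; suff : false by []; apply: F; apply/andP; split; lra.
  have := offset_lt lt => olt; have := @sin_gt0_pi R (offset k - offset k').
  by rewrite -opprB sinN sE oppr0 ltxx; move=> F; suff : false by []; apply: F;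
    apply/andP; split; lra.
rewrite /total nneseries_esumT; last by move=> i; apply: nneseries_ge0 => k _ _;
  rewrite lee_fin.
under [RHS]eq_esum => i _.
  rewrite nneseries_esumT; last by move=> k; rewrite lee_fin.
  over.
rewrite esum_esum; last by move=> i k; rewrite lee_fin.
rewrite esum_mkcond (_ : setT `*`` _ = setT); last by apply/seteqP.
apply: eq_esum => -[i k] _ /=; rewrite indicE.
by rewrite (_ : ((i, k) \in I) = (w \in hit i k))//; case: ifPn.
Qed.

Lemma integral_count_Psi :
  (\int[P]_w count_Psi n (X w) (th w) 0 l)%E =
  ((2 ^+ n * Num.sqrt lam / pi) * l)%:E.
Proof.
have [N [mN N0 badN]] := bad_negligible.
have mh i k : measurable_fun setT (fun w => (\1_(hit i k) w : R)%:E).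
  by apply/measurable_EFinP; exact: measurable_indic.
have ms i : measurable_fun setT (fun w => \sum_(k <oo) (\1_(hit i k) w : R)%:E)%E.
  by apply: ge0_emeasurable_sum => k; [move=> w _ _; rewrite lee_fin|].
have s0 i w : (0 <= \sum_(k <oo) (\1_(hit i k) w : R)%:E)%E.
  by apply: nneseries_ge0 => k _ _; rewrite lee_fin.
(* Measurability is required of [total] only; for [count_Psi] nonnegativity suffices. *)
rewrite (@ge0_integral_eq_off_null _ _ _ P _ total N mN N0); last 4 first.
- by apply: ge0_emeasurable_sum.
- by move=> w; apply: esum_ge0.
- by move=> w; apply: nneseries_ge0.
- by move=> w Nw; apply: count_Psi_total => /badN.
rewrite /total integral_nneseries//.
transitivity (\sum_(i <oo) ((K%:R * pi^-1)%:E * cell_mass i))%E.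
  apply: eq_eseriesr => i _; rewrite integral_nneseries//.
  rewrite (@nneseries_split _ _ 0 K); last by move=> k _; exact: integral_ge0.
  rewrite [X in (_ + X)%E]eseries0 ?adde0; last first.
    move=> k Kk _; apply: integral0_eq => w _; rewrite indicE memNset// => -[].
    by rewrite ltnNge Kk.
  rewrite big_mkord (eq_bigr (fun=> (1%:E * (pi^-1%:E * cell_mass i))%E)); last first.
    move=> k _; rewrite mul1e; transitivity (P (hit i k)); last exact: hit_prob.
    by rewrite integral_indic// setIT.
  by rewrite -ge0_sume_distrl// sumEFin sumr_const card_ord EFinM -muleA.
rewrite nneseriesZl; last first.
  move=> i _; apply: integral_ge0 => w _; apply: integral_ge0 => s _.
  exact: (cell_density_ge0 i (w, s)).
rewrite sum_cell_mass -EFinM; congr EFin.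
(* By [n1] the truncated [n - 1] is a true difference, so the 2 of [2 * Num.sqrt lam] raises
   [2 ^ (n - 1)] to [2 ^ n]. *)
rewrite natrX -[in RHS](subnK n1) exprD expr1.
have : (pi : R) != 0 by rewrite gt_eqF// pi_gt0.
by move: (pi : R) => p p0; field.
Qed.

End beam_count.

Theorem theorem2 (R : realType) (d : measure_display) (T : measurableType d)
  (P : probability T R) (lam : R) (X : T -> nat -> R * R) (th : T -> nat -> R)
  (n : nat) (v : R) :
  0 < lam -> (1 <= n)%N -> 0 < v ->
  homogeneous_PPP P lam X -> iid_uniform_marks P X th ->
  (forall l : R, 0 < l ->
     (\int[P]_w count_Psi n (X w) (th w) 0 l)%E
     = ((2 ^+ n * Num.sqrt lam / pi) * l)%:E) /\
  (forall t : R, 0 < t ->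
     (\int[P]_w count_Psi n (X w) (th w) 0 (v * t))%E
     = ((2 ^+ n * Num.sqrt lam / pi * v) * t)%:E).
Proof.
move=> lam0 n1 v0 PPP marks; split => [l l0|t t0].
  exact: integral_count_Psi.
by rewrite -mulrA; apply: integral_count_Psi => //; exact: mulr_gt0.
Qed.
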